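(* Let $A$ be a finite dimensional weak $C^*$-Hopf algebra, $\triangleright:A\otimes M\to M$ an $A$-module algebra, $h\in A$ the normalized Haar integral, $\lambda_h\in\mathcal L(\hat A)$ the left integral dual to $h$, and $\hat E:=\hat E_{\lambda_h}:M\rtimes A\to M$. For $x\in M'\cap(M\rtimes A)$ and $a\in A$ put $t_x(a):=\hat E(ax)\in M$. Then the assignment $x\mapsto t_x$ is a $C(M)$-module isomorphism $$M'\cap(M\rtimes A)\to\mathcal T_\triangleright(M)$$ onto the space of inner implementers, satisfying $t_{(1_M\rtimes A_R)}=\mathcal T^0_\triangleright(M)$. In particular, the action $\triangleright$ is outer if and only if $M'\cap(M\rtimes A)=(C(M)\rtimes A_R)$.
   Context: A finite dimensional weak $C^*$-Hopf algebra is a finite dimensional $C^*$-algebra $A$ (unit $1$) with linear maps $\Delta:A\to A\otimes A$, $\varepsilon:A\to\mathbb C$, $S:A\to A$ such that, for all $x,y,z\in A$ in Sweedler notation: $\Delta(xy)=\Delta(x)\Delta(y)$; $\Delta(x^* )=\Delta(x)^*$; $(\Delta\otimes\mathrm{id})\Delta=(\mathrm{id}\otimes\Delta)\Delta$; $(\Delta(1)\otimes1)(1\otimes\Delta(1))=1_{(1)}\otimes1_{(2)}\otimes1_{(3)}$; $(\varepsilon\otimes\mathrm{id})\Delta=\mathrm{id}=(\mathrm{id}\otimes\varepsilon)\Delta$; $\varepsilon(xyz)=\varepsilon(xy_{(1)})\varepsilon(y_{(2)}z)$; $S(x_{(1)})x_{(2)}=1_{(1)}\varepsilon(x1_{(2)})$;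 $x_{(1)}S(x_{(2)})=\varepsilon(1_{(1)}x)1_{(2)}$; $S(x_{(1)})x_{(2)}S(x_{(3)})=S(x)$. ($\Delta(1)\neq 1\otimes 1$ in general; $S$ is automatically invertible.) Put $x_*:=S(x)^*$. The dual $\hat A$ is the dual vector space with $\langle\psi\varphi|x\rangle=\langle\psi\otimes\varphi|\Delta(x)\rangle$, $\langle\hat\Delta(\psi)|x\otimes y\rangle=\langle\psi|xy\rangle$, $\hat1=\varepsilon$, $\hat\varepsilon(\psi)=\langle\psi|1\rangle$, $\langle\hat S(\psi)|x\rangle=\langle\psi|S(x)\rangle$, $\langle\psi^*|x\rangle=\overline{\langle\psi|x_*\rangle}$; it is again a finite dimensional weak $C^*$-Hopf algebra, with dual $A$. Write $\varphi\rightharpoonup a=a_{(1)}\langle\varphi|a_{(2)}\rangle$. $A_L=\{(\varphi\otimes\mathrm{id})(\Delta(1)):\varphi\in\hat A\}$, $A_R=\{(\mathrm{id}\otimes\varphi)(\Delta(1)):\varphi\in\hat A\}$. Left integrals: $\mathcal L(\hat A)$ is the space of $\lambda\in\hat A$ with $\psi\lambda=\psi_{(1)}\hat S(\psi_{(2)})\lambda$ for all $\psi\in\hat A$ (analogously $\mathcal L(A)$). The normalized Haar integral $h\in A$ is the unique element with $ah=a_{(1)}S(a_{(2)})h$, $ha=hS(a_{(1)})a_{(2)}$ for all $a\in A$ and $S(h_{(1)})h_{(2)}=h_{(1)}S(h_{(2)})=1$. The left integral dual to $h$ is the unique $\lambda_h\in\hat A$ with $\lambda_h\rightharpoonup h=1$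 (it is a nondegenerate left integral). An $A$-module algebra is a unital $*$-algebra $M$ with a linear left action $\triangleright$ of $A$ with $(ab)\triangleright m=a\triangleright(b\triangleright m)$, $1\triangleright m=m$, $a\triangleright(mn)=(a_{(1)}\triangleright m)(a_{(2)}\triangleright n)$, $(a\triangleright m)^*=a_*\triangleright m^*$, $a\triangleright1_M=(a_{(1)}S(a_{(2)}))\triangleright1_M$. Its dual coaction is the map $\hat\rho:M\to M\otimes\hat A$ determined by $a\triangleright m=(\mathrm{id}\otimes a)(\hat\rho(m))$. The crossed product $M\rtimes A=M\otimes_{A_L}A$ (elements $(m\rtimes a)$ modulo $(m\rtimes ba)=(m(b\triangleright1_M)\rtimes a)$, $b\in A_L$) has product $(m\rtimes a)(m'\rtimes a')=(m(a_{(1)}\triangleright m')\rtimes a_{(2)}a')$; write $m\equiv m\rtimes1$, $a\equiv1_M\rtimes a$. For $\lambda\in\mathcal L(\hat A)$, $\hat E_\lambda:M\rtimes A\to M$ is $\hat E_\lambda(m\rtimes a)=m\rtimes(\lambda\rightharpoonup a)=m((\lambda\rightharpoonup a)\triangleright1_M)$. $M'\cap(M\rtimes A)$ is the commutant of $M$ and $C(M)$ the center of $M$; $(C(M)\rtimes A_R)$ is the span of $(z\rtimes a)$, $z\in C(M)$, $a\in A_R$. Implementers: $\mathcal T_\triangleright(M)$ is the space of $T\in M\otimes\hat A$ with $T(m\otimes\hat1)=\hat\rho(m)T$ for all $m\in M$; identifying $T$ with the linear map $A\to M$, $T(a)=(\mathrm{id}\otimes a)(T)$, this means $T(a)m=(a_{(1)}\triangleright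 m)T(a_{(2)})$ for all $a,m$. It is a $C(M)$-module by $(zT)(a)=zT(a)$. The trivial implementers are $\mathcal T^0_\triangleright(M):=\hat\rho(1_M)(1_M\otimes\mathcal L(\hat A))\subset\mathcal T_\triangleright(M)$. The action is called outer if $\mathcal T_\triangleright(M)=C(M)\mathcal T^0_\triangleright(M)$. *)

(* Defs.v *)
From HB Require Import structures.
From mathcomp Require Import all_boot all_order all_algebra all_field.
From mathcomp Require Import ring_quotient complex.
From mathcomp Require Import boolp classical_sets functions reals.

Set Implicit Arguments.
Unset Strict Implicit.
Unset Printing Implicit Defensive.

Import Order.TTheory GRing.Theory Num.Theory.

Local Open Scope classical_set_scope.
Local Open Scope ring_scope.

(* The second factor is finite dimensional with basis e_i, so an element of
   U (x) V is a unique sum of u_i (x) e_i, and is stored as the family (u_i).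
   U may be infinite dimensional.  By [tsum_pure] and [tens_sum] below this is
   the tensor product over K. *)
Definition tens (K : fieldType) (U : lmodType K) (V : vectType K) :=
  {ffun 'I_(\dim {:V}) -> U}.

Section Tensor.
Variable K : fieldType.
Implicit Types (U : lmodType K) (V : vectType K) (W : zmodType).

Definition pure U V (u : U) (v : V) : tens U V :=
  [ffun i => coord (vbasis {:V}) i v *: u].

Definition tsum U V W (B : U -> V -> W) (t : tens U V) : W :=
  \sum_i B (t i) (vbasis {:V})`_i.

Definition tmul U V (mulU : U -> U -> U) (mulV : V -> V -> V)
    (s t : tens U V) : tens U V :=
  tsum (fun u v => tsum (fun u' v' => pure (mulU u u') (mulV v v')) t) s.

Definition dual V := 'Hom(V, K^o).

Definition dual_basis V (i : 'I_(\dim {:V})) : dual V :=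
  linfun (fun v : V => coord (vbasis {:V}) i v : K^o).

(* U (x) V^ is identified with the linear maps V -> U: [tens_eval t] is the
   map v |-> (id (x) v)(t), and [tens_of_map f] the tensor of a linear map f. *)
Definition tens_eval U V (t : tens U (dual V)) (v : V) : U :=
  tsum (fun u (phi : dual V) => phi v *: u) t.

Definition tens_of_map U V (f : V -> U) : tens U (dual V) :=
  \sum_(i < \dim {:V}) pure (f (vbasis {:V})`_i) (dual_basis i).

(* Additive in each argument and K-balanced.  Scalars need not come out, so
   that maps antilinear in both arguments are covered as well. *)
Record balanced U V W (B : U -> V -> W) : Prop := Balanced {
  balDl : forall u u' v, B (u + u') v = B u v + B u' v;
  balDr : forall u v v', B u (v + v') = B u v + B u v';
  balZ : forall k u v, B (k *: u) v = B u (k *: v) }.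

Record bilinear_map U U' (U'' : lmodType K) (f : U -> U' -> U'') : Prop :=
  Bilinear {
  bilDl : forall u u' v, f (u + u') v = f u v + f u' v;
  bilDr : forall u v v', f u (v + v') = f u v + f u v';
  bilZl : forall k u v, f (k *: u) v = k *: f u v;
  bilZr : forall k u v, f u (k *: v) = k *: f u v }.

End Tensor.

Notation "u \ox v" := (pure u v) (at level 40, left associativity) : ring_scope.
(* Sweedler notation: [\tsum_(x, y <- t) F x y] is F t_(1) t_(2). *)
Notation "\tsum_ ( x , y <- t ) F" := (tsum (fun x y => F) t)
  (at level 41, x name, y name, t at level 35, F at level 41,
   format "\tsum_ ( x ,  y  <-  t )  F") : ring_scope.

Section TensorTheory.
Variable K : fieldType.
Implicit Types (U : lmodType K) (V : vectType K) (W : zmodType).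

Lemma bal0l U V W (B : U -> V -> W) : balanced B -> forall v, B 0 v = 0.
Proof. by case=> D _ _ v; apply: (addrI (B 0 v)); rewrite -D !addr0. Qed.

Lemma bal0r U V W (B : U -> V -> W) : balanced B -> forall u, B u 0 = 0.
Proof. by case=> _ D _ u; apply: (addrI (B u 0)); rewrite -D !addr0. Qed.

Lemma tsum_pure U V W (B : U -> V -> W) : balanced B ->
  forall u v, tsum B (u \ox v) = B u v.
Proof.
move=> bB u v; rewrite [in RHS](coord_vbasis (memvf v)).
rewrite (big_morph (B u) (balDr bB u) (bal0r bB u)).
by apply: eq_bigr => i _; rewrite ffunE (balZ bB).
Qed.

Lemma tens_sum U V (t : tens U V) :
  t = \tsum_(u, v <- t) u \ox v.
Proof.
apply/ffunP => j; rewrite /tsum sum_ffunE (bigD1 j) //= big1 ?addr0 => [|i ij].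
  by rewrite ffunE coord_free ?(basis_free (vbasisP _)) // eqxx scale1r.
rewrite ffunE coord_free ?(basis_free (vbasisP _)) // (negbTE ij).
by rewrite scale0r.
Qed.

Lemma tsumD U V W (B : U -> V -> W) : balanced B ->
  {morph tsum B : s t / s + t}.
Proof.
move=> bB s t; rewrite /tsum -big_split; apply: eq_bigr => i _.
by rewrite ffunE (balDl bB).
Qed.

Lemma tsum0 U V W (B : U -> V -> W) : balanced B -> tsum B 0 = 0.
Proof. by move=> bB; apply: (addrI (tsum B 0)); rewrite -tsumD // !addr0. Qed.

Lemma tsumN U V W (B : U -> V -> W) : balanced B ->
  {morph tsum B : s / - s}.
Proof.
by move=> bB s; apply/eqP; rewrite -addr_eq0 -tsumD // addNr tsum0.
Qed.

Lemma tsum_bigsum U V W (B : U -> V -> W) (I : Type) (r : seq I) F :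
  balanced B -> tsum B (\sum_(i <- r) F i) = \sum_(i <- r) tsum B (F i).
Proof. by move=> bB; apply: (big_morph _ (tsumD bB) (tsum0 bB)). Qed.

Lemma tsum_tsum U V U' V' W (B : U' -> V' -> W) (G : U -> V -> tens U' V') t :
  balanced B -> tsum B (tsum G t) = \tsum_(u, v <- t) tsum B (G u v).
Proof. by move=> bB; rewrite /(tsum G) tsum_bigsum. Qed.

Lemma eq_tsum U V W (B B' : U -> V -> W) t :
  (forall u v, B u v = B' u v) -> tsum B t = tsum B' t.
Proof. by move=> e; apply: eq_bigr => i _; apply: e. Qed.

Lemma tsumDf U V W (B B' B'' : U -> V -> W) t :
  (forall u v, B u v = B' u v + B'' u v) -> tsum B t = tsum B' t + tsum B'' t.
Proof. by move=> e; rewrite /tsum -big_split; apply: eq_bigr => i _. Qed.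

Lemma raddf_tsum U V W W' (f : W -> W') (B : U -> V -> W) t :
  {morph f : x y / x + y} -> f (tsum B t) = \tsum_(u, v <- t) f (B u v).
Proof.
move=> fD; have f0 : f 0 = 0 by apply: (addrI (f 0)); rewrite -fD !addr0.
exact: (big_morph f fD f0).
Qed.

Lemma exchange_tsum U V U' V' W (B : U -> V -> U' -> V' -> W) s t :
  \tsum_(u, v <- s) \tsum_(u', v' <- t) B u v u' v' =
  \tsum_(u', v' <- t) \tsum_(u, v <- s) B u v u' v'.
Proof. exact: exchange_big. Qed.

Lemma pure_balanced U V : balanced (@pure K U V).
Proof.
split=> [u u' v|u v v'|k u v]; apply/ffunP => i; rewrite !ffunE.
- exact: scalerDr.
- by rewrite linearD scalerDl.
- by rewrite scalerA mulrC linearZ.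
Qed.

Lemma pureZl U V k (u : U) (v : V) : (k *: u) \ox v = k *: (u \ox v).
Proof. by apply/ffunP => i; rewrite !ffunE !scalerA mulrC. Qed.

Lemma pureZr U V k (u : U) (v : V) : u \ox (k *: v) = k *: (u \ox v).
Proof. by rewrite -(balZ (pure_balanced _ _)) pureZl. Qed.

Lemma pureNl U V (u : U) (v : V) : (- u) \ox v = - (u \ox v).
Proof. by apply/ffunP => i; rewrite !ffunE scalerN. Qed.

Lemma tsumZ U V (W : lmodType K) (B : U -> V -> W) :
  (forall k u v, B (k *: u) v = k *: B u v) ->
  forall k t, tsum B (k *: t) = k *: tsum B t.
Proof.
by move=> BZ k t; rewrite /tsum scaler_sumr; apply: eq_bigr => i _;
   rewrite ffunE BZ.
Qed.

(* Two additive maps that agree on the pure tensors are equal. *)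
Lemma tens_ext U V W (f g : tens U V -> W) :
  {morph f : x y / x + y} -> {morph g : x y / x + y} ->
  (forall u v, f (u \ox v) = g (u \ox v)) -> f =1 g.
Proof.
move=> fD gD e t; rewrite (tens_sum t) (raddf_tsum _ _ fD) (raddf_tsum _ _ gD).
exact: eq_tsum.
Qed.

Lemma dual_basisE V i (v : V) : dual_basis i v = coord (vbasis {:V}) i v.
Proof. exact: lfunE. Qed.

Lemma eval_balanced U V v : balanced (fun (u : U) (phi : dual V) => phi v *: u).
Proof.
split=> [u u' phi|u phi psi|k u phi]; first exact: scalerDr.
  by rewrite lfunE /= scalerDl.
by rewrite lfunE /= !scalerA mulrC.
Qed.

Lemma slicel_balanced V (W : vectType K) (phi : dual V) :
  balanced (fun (v : V) (w : W) => phi v *: w).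
Proof.
split=> [v v' w|v w w'|k v w]; first by rewrite linearD scalerDl.
  by rewrite scalerDr.
by rewrite scalerA mulrC linearZ.
Qed.

Lemma slicer_balanced V (W : lmodType K) (phi : dual V) :
  balanced (fun (w : W) (v : V) => phi v *: w).
Proof.
split=> [w w' v|w v v'|k w v]; first by rewrite scalerDr.
  by rewrite linearD scalerDl.
by rewrite scalerA mulrC linearZ.
Qed.

Lemma tens_of_mapK U V (f : V -> U) : linear f ->
  tens_eval (tens_of_map f) =1 f.
Proof.
move=> f_lin v; pose F := GRing.isLinear.Build _ _ _ _ f f_lin.
pose g : {linear V -> U} := HB.pack f F.
rewrite /tens_eval /tens_of_map tsum_bigsum; last exact: eval_balanced.
rewrite [in RHS](coord_vbasis (memvf v)) -[f]/(g : V -> U) linear_sum.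
apply: eq_bigr => i _; rewrite tsum_pure; last exact: eval_balanced.
by rewrite dual_basisE linearZ.
Qed.

Lemma tens_evalK U V (t : tens U (dual V)) : tens_of_map (tens_eval t) = t.
Proof.
have evD : forall v, {morph (fun t : tens U (dual V) => tens_eval t v) :
  x y / x + y} by move=> v; apply: tsumD; apply: eval_balanced.
apply: (tens_ext (f := fun t => tens_of_map (tens_eval t)) (g := id)) => //.
  move=> x y /=; rewrite /tens_of_map -big_split; apply: eq_bigr => i _ /=.
  by rewrite evD (balDl (pure_balanced _ _)).
move=> u phi; rewrite /tens_of_map; transitivity (\sum_(i < \dim {:V})
   (u \ox (phi (vbasis {:V})`_i *: dual_basis i))).
  apply: eq_bigr => i _; rewrite /tens_eval tsum_pure; last exact: eval_balanced.
  exact: (balZ (pure_balanced _ _)).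
rewrite -(big_morph _ (balDr (pure_balanced _ _) u) (bal0r (pure_balanced _ _) u)).
congr (_ \ox _); apply/lfunP => v; rewrite sum_lfunE.
rewrite [in RHS](coord_vbasis (memvf v)) linear_sum; apply: eq_bigr => i _ /=.
by rewrite lfunE /= dual_basisE linearZ /= [RHS]mulrC.
Qed.

Lemma mul_bilinear (B : algType K) : bilinear_map (@GRing.mul B).
Proof.
split=> [x y z|x y z|k x y|k x y]; [exact: mulrDl|exact: mulrDr| |].
  by rewrite scalerAl.
by rewrite scalerAr.
Qed.

Section TensorAlgebra.
Variables (U : lmodType K) (V : vectType K).
Variables (mulU : U -> U -> U) (mulV : V -> V -> V).
Hypotheses (bU : bilinear_map mulU) (bV : bilinear_map mulV).
Local Notation mu := (tmul mulU mulV).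

Lemma tmul_balancedr u v :
  balanced (fun u' v' => mulU u u' \ox mulV v v').
Proof.
split=> [x x' y|x y y'|k x y].
- by rewrite (bilDr bU) (balDl (pure_balanced _ _)).
- by rewrite (bilDr bV) (balDr (pure_balanced _ _)).
- by rewrite (bilZr bU) (bilZr bV) (balZ (pure_balanced _ _)).
Qed.

Lemma tmul_balancedl t :
  balanced (fun u v => \tsum_(u', v' <- t) mulU u u' \ox mulV v v').
Proof.
split=> [x x' y|x y y'|k x y].
- by apply: tsumDf => *; rewrite (bilDl bU) (balDl (pure_balanced _ _)).
- by apply: tsumDf => *; rewrite (bilDl bV) (balDr (pure_balanced _ _)).
- by apply: eq_tsum => *; rewrite (bilZl bU) (bilZl bV) (balZ (pure_balanced _ _)).
Qed.

Lemma tmul_bilinear : bilinear_map mu.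
Proof.
split=> [s s' t|s t t'|k s t|k s t].
- by rewrite /tmul tsumD //; apply: tmul_balancedl.
- by apply: tsumDf => *; rewrite tsumD //; apply: tmul_balancedr.
- rewrite /tmul tsumZ // => l x y; rewrite -tsumZ => [|l' x' y'].
    by apply: eq_bigr => i _; rewrite ffunE (bilZl bU) (bilZr bU).
  by rewrite (bilZr bU) pureZl.
- rewrite [RHS]raddf_tsum => [|x y]; last exact: scalerDr.
  apply: eq_tsum => u v; rewrite tsumZ // => l x y.
  by rewrite (bilZr bU) pureZl.
Qed.

Lemma tmul_purel u v t :
  mu (u \ox v) t = \tsum_(u', v' <- t) mulU u u' \ox mulV v v'.
Proof. by rewrite /tmul tsum_pure //; apply: tmul_balancedl. Qed.

Lemma tmul_pure u v u' v' :
  mu (u \ox v) (u' \ox v') = mulU u u' \ox mulV v v'.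
Proof. by rewrite tmul_purel tsum_pure //; apply: tmul_balancedr. Qed.

Lemma tmul_purer u v t :
  mu t (u \ox v) = \tsum_(u', v' <- t) mulU u' u \ox mulV v' v.
Proof.
apply: eq_tsum => u' v'; rewrite tsum_pure //; exact: tmul_balancedr.
Qed.

Lemma tmulA : associative mulU -> associative mulV -> associative mu.
Proof.
move=> aU aV r s t; have [Dl Dr _ _] := tmul_bilinear.
apply: (tens_ext (f := fun r => mu r (mu s t)) (g := fun r => mu (mu r s) t)).
- by move=> x y /=; rewrite Dl.
- by move=> x y /=; rewrite !Dl.
move=> u v; apply: (tens_ext (f := fun s => mu (u \ox v) (mu s t))
  (g := fun s => mu (mu (u \ox v) s) t)).
- by move=> x y /=; rewrite Dl Dr.
- by move=> x y /=; rewrite Dr Dl.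
move=> u' v'; apply: (tens_ext (f := fun t => mu (u \ox v) (mu (u' \ox v') t))
  (g := fun t => mu (mu (u \ox v) (u' \ox v')) t)).
- by move=> x y /=; rewrite !Dr.
- by move=> x y /=; rewrite Dr.
by move=> u'' v''; rewrite !tmul_pure aU aV.
Qed.

End TensorAlgebra.

End TensorTheory.

(* Finite sums of elements of S.  For S stable under complex scalars, as in
   all uses below, this is the complex linear span. *)
Definition addspan (V : zmodType) (S : set V) : set V :=
  [set x | exists2 s : seq V, (forall y, y \in s -> S y) & x = \sum_(y <- s) y].

Lemma addspan_zmod_closed (V : zmodType) (S : set V) :
  (forall x, S x -> S (- x)) -> zmod_closed [pred x | `[< addspan S x >]].
Proof.
move=> SN; split=> [|x y].
  by apply/asboolP; exists [::]; rewrite ?big_nil.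
move=> /asboolP[s Ss ->] /asboolP[t St ->]; apply/asboolP.
exists (s ++ [seq - z | z <- t]) => [z|].
  by rewrite mem_cat => /orP[/Ss//|/mapP[w /St + ->]]; exact: SN.
by rewrite big_cat big_map /= sumrN.
Qed.

Section WeakHopf.
(* The theorem takes C := R[i] with R : realType. *)
Variable C : numClosedFieldType.

Record is_star (B : lalgType C) (s : B -> B) : Prop := IsStar {
  star_antilinear : forall (c : C) x y, s (c *: x + y) = c^* *: s x + s y;
  star_antimul : forall x y, s (x * y) = s y * s x;
  star_involutive : involutive s }.

(* In the order of C, 0 <= z means that z is a nonnegative real.  On a finite
   dimensional algebra completeness of the norm is automatic. *)
Record is_Cstar_norm (B : lalgType C) (s : B -> B) (N : B -> C) : Prop :=
  IsCstarNorm {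
  Cnorm_ge0 : forall x, 0 <= N x;
  Cnorm_eq0 : forall x, N x = 0 -> x = 0;
  CnormD : forall x y, N (x + y) <= N x + N y;
  CnormZ : forall (c : C) x, N (c *: x) = `|c| * N x;
  CnormM : forall x y, N (x * y) <= N x * N y;
  Cnorm_Cstar : forall x, N (s x * x) = N x ^+ 2 }.

Record weak_Cstar_Hopf (A : falgType C) := WeakCstarHopf {
  star : A -> A;
  comul : 'Hom(A, tens A A);
  counit : dual A;
  antipode : 'End(A);
  starP : is_star star;
  CstarP : exists N, is_Cstar_norm star N;
  comulM : forall x y, comul (x * y) = tmul *%R *%R (comul x) (comul y);
  comul_star : forall x,
    comul (star x) = \tsum_(x1, x2 <- comul x) star x1 \ox star x2;
  comulA : forall x,
    \tsum_(x1, x2 <- comul x) comul x1 \ox x2 =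
    \tsum_(x1, x2 <- comul x) \tsum_(x2', x3 <- comul x2) x1 \ox x2' \ox x3;
  comul1 :
    tmul (tmul *%R *%R) *%R
      (comul 1 \ox 1) (\tsum_(x1, x2 <- comul 1) 1 \ox x1 \ox x2) =
    \tsum_(x1, x2 <- comul 1) comul x1 \ox x2;
  counitl : forall x, \tsum_(x1, x2 <- comul x) counit x1 *: x2 = x;
  counitr : forall x, \tsum_(x1, x2 <- comul x) counit x2 *: x1 = x;
  counitM : forall x y z,
    counit (x * y * z) =
    \tsum_(y1, y2 <- comul y) counit (x * y1) * counit (y2 * z);
  antipodel : forall x,
    \tsum_(x1, x2 <- comul x) antipode x1 * x2 =
    \tsum_(u1, u2 <- comul 1) counit (x * u2) *: u1;
  antipoder : forall x,
    \tsum_(x1, x2 <- comul x) x1 * antipode x2 =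
    \tsum_(u1, u2 <- comul 1) counit (u1 * x) *: u2;
  antipodeP : forall x,
    \tsum_(x1, x2 <- comul x) \tsum_(x2', x3 <- comul x2)
      antipode x1 * x2' * antipode x3 = antipode x }.

Section Structures.
Variables (A : falgType C) (H : weak_Cstar_Hopf A).
Local Notation Delta := (comul H).
Local Notation S := (antipode H).

(* A_L and A_R *)
Definition A_left : set A :=
  [set b | exists phi : dual A, b = \tsum_(x, y <- Delta 1) phi x *: y].

Definition A_right : set A :=
  [set b | exists phi : dual A, b = \tsum_(x, y <- Delta 1) phi y *: x].

Definition dual_mul (psi phi : dual A) : dual A :=
  linfun (fun x => \tsum_(x1, x2 <- Delta x) psi x1 * phi x2 : C^o).

(* The coproduct with <dual_comul psi | x (x) y> = psi (x y), by [dual_comulE]. *)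
Definition dual_comul (psi : dual A) : tens (dual A) (dual A) :=
  tens_of_map (fun y : A => linfun (fun x => psi (x * y)) : dual A).

Definition dual_antipode (psi : dual A) : dual A := (psi \o S)%VF.

Definition left_integral : set (dual A) :=
  [set lambda | forall psi,
    dual_mul psi lambda =
    \tsum_(psi1, psi2 <- dual_comul psi)
      dual_mul (dual_mul psi1 (dual_antipode psi2)) lambda].

Record Haar_integral (h : A) : Prop := HaarIntegral {
  Haar_left : forall a, a * h = (\tsum_(a1, a2 <- Delta a) a1 * S a2) * h;
  Haar_right : forall a, h * a = h * \tsum_(a1, a2 <- Delta a) S a1 * a2;
  Haar_norml : \tsum_(h1, h2 <- Delta h) S h1 * h2 = 1;
  Haar_normr : \tsum_(h1, h2 <- Delta h) h1 * S h2 = 1 }.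

Definition harpoon (phi : dual A) (a : A) : A :=
  \tsum_(a1, a2 <- Delta a) phi a2 *: a1.

Record module_algebra (M : algType C) := ModuleAlgebra {
  mstar : M -> M;
  act : A -> M -> M;
  mstarP : is_star mstar;
  act_linearl : forall m, linear (act^~ m);
  act_linearr : forall a, linear (act a);
  actA : forall a b m, act (a * b) m = act a (act b m);
  act1 : forall m, act 1 m = m;
  actM : forall a m n,
    act a (m * n) = \tsum_(a1, a2 <- Delta a) act a1 m * act a2 n;
  act_star : forall a m, mstar (act a m) = act (star H (S a)) (mstar m);
  act_one : forall a,
    act a 1 = act (\tsum_(a1, a2 <- Delta a) a1 * S a2) 1 }.

End Structures.

Section Legs.
Variables (A : falgType C) (H : weak_Cstar_Hopf A).
Local Notation Delta := (comul H).
Local Notation S := (antipode H).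

Record trilinear_map (W : zmodType) (F : A -> A -> A -> W) : Prop := Trilinear {
  triD1 : forall x x' y z, F (x + x') y z = F x y z + F x' y z;
  triD2 : forall x y y' z, F x (y + y') z = F x y z + F x y' z;
  triD3 : forall x y z z', F x y (z + z') = F x y z + F x y z';
  triZ12 : forall k x y z, F (k *: x) y z = F x (k *: y) z;
  triZ13 : forall k x y z, F (k *: x) y z = F x y (k *: z) }.

Lemma comul_coassoc (W : zmodType) (F : A -> A -> A -> W) x :
  trilinear_map F ->
  \tsum_(x1, x2 <- Delta x) \tsum_(p, q <- Delta x1) F p q x2 =
  \tsum_(x1, x2 <- Delta x) \tsum_(p, q <- Delta x2) F x1 p q.
Proof.
case=> D1 D2 D3 Z12 Z13.
have b1 z : balanced (fun p q => F p q z) by split.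
pose G (t : tens A A) z := \tsum_(p, q <- t) F p q z.
have bG : balanced G.
  split=> [t t' z|t z z'|k t z]; first exact: tsumD.
    exact: tsumDf.
  rewrite /G /tsum; apply: eq_bigr => i _.
  by rewrite ffunE Z13.
have := congr1 (tsum G) (comulA H x); rewrite !tsum_tsum //.
under eq_tsum do rewrite tsum_pure //.
move=> ->; apply: eq_tsum => x1 x2; rewrite tsum_tsum //.
by apply: eq_tsum => p q; rewrite tsum_pure // /G tsum_pure.
Qed.

Lemma mulAP : associative (@tmul C A A *%R *%R).
Proof. by apply: tmulA; [exact: mul_bilinear.. | exact: mulrA | exact: mulrA]. Qed.

Lemma comul_A_left b : A_left H b ->
  Delta b = \tsum_(x, y <- Delta 1) (b * x) \ox y.
Proof.
case=> phi bE.
pose G (t : tens A A) (c : A) := \tsum_(p, q <- t) phi p *: (q \ox c).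
have b1 c : balanced (fun p q : A => phi p *: (q \ox c)).
  split=> [u u' v|u v v'|k u v]; first by rewrite linearD scalerDl.
    by rewrite (balDl (pure_balanced _ _)) scalerDr.
  by rewrite linearZ /= pureZl !scalerA mulrC.
have bG : balanced G.
  split=> [t t' z|t z z'|k t z]; first exact: tsumD.
    by apply: tsumDf => ? ?; rewrite (balDr (pure_balanced _ _)) scalerDr.
  rewrite /G /tsum; apply: eq_bigr => i _.
  by rewrite ffunE linearZ /= pureZr !scalerA mulrC.
have bAA := tmul_bilinear (@mul_bilinear C A) (@mul_bilinear C A).
have bP : balanced (fun (u : tens A A) v =>
    G (tmul *%R *%R (Delta 1) u) (1 * v)).
  split=> [x x' y|x y y'|k x y].
  - by rewrite (bilDr bAA) (balDl bG).
  - by rewrite mulrDr (balDr bG).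
  - by rewrite (bilZr bAA) (balZ bG) scalerAr.
have := congr1 (tsum G) (comul1 H).
rewrite tmul_purel //; last exact: mul_bilinear.
rewrite (tsum_tsum _ _ bG); under eq_tsum do rewrite tsum_pure //.
rewrite (tsum_tsum _ _ bP); under eq_tsum do rewrite (tsum_pure bP).
rewrite [X in _ = X](tsum_tsum _ _ bG).
under [X in _ = X]eq_tsum do rewrite (tsum_pure bG).
rewrite /G comul_coassoc => [E|]; last first.
  split=> [x x' y z|x y y' z|x y z z'|k x y z|k x y z].
  - by rewrite linearD scalerDl.
  - by rewrite (balDl (pure_balanced _ _)) scalerDr.
  - by rewrite (balDr (pure_balanced _ _)) scalerDr.
  - by rewrite linearZ /= pureZl !scalerA mulrC.
  - by rewrite linearZ /= pureZr !scalerA mulrC.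
rewrite [LHS](_ : _ = \tsum_(x1, x2 <- Delta 1) phi x1 *: Delta x2); last first.
  rewrite bE (raddf_tsum (f := Delta)) => [|x y]; last exact: linearD.
  by apply: eq_tsum => x y; rewrite linearZ.
transitivity (\tsum_(x1, x2 <- Delta 1) \tsum_(p, q <- Delta x2)
    phi x1 *: (p \ox q)).
  apply: eq_tsum => x y; rewrite {1}(tens_sum (Delta y)).
  by apply: (raddf_tsum (f := *:%R (phi x))) => ? ?; apply: scalerDr.
rewrite -E; apply: eq_tsum => x1 x2.
rewrite tmul_purer; [|exact: mul_bilinear..].
rewrite tsum_tsum // bE mul1r.
rewrite (raddf_tsum (f := fun t => (t * x1) \ox x2)) => [|x y]; last first.
  by rewrite mulrDl (balDl (pure_balanced _ _)).
by apply: eq_tsum => x y; rewrite tsum_pure // mulr1 -scalerAl pureZl.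
Qed.

Lemma starD : {morph star H : x y / x + y}.
Proof.
by move=> x y; have := star_antilinear (starP H) 1 x y; rewrite conjC1 !scale1r.
Qed.

Lemma starZ k x : star H (k *: x) = k^* *: star H x.
Proof.
have s0 : star H 0 = 0 by apply: (addrI (star H 0)); rewrite -starD !addr0.
by have := star_antilinear (starP H) k x 0; rewrite s0 !addr0.
Qed.

Lemma star_bal : balanced (fun x y : A => star H x \ox star H y).
Proof.
split=> [x x' y|x y y'|k x y].
- by rewrite starD (balDl (pure_balanced _ _)).
- by rewrite starD (balDr (pure_balanced _ _)).
- by rewrite !starZ (balZ (pure_balanced _ _)).
Qed.

Lemma star1 : star H 1 = 1.
Proof.
have sM := star_antimul (starP H); have sK := star_involutive (starP H).
by apply: (can_inj sK); rewrite -[star H 1]mulr1 sM sK mulr1.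
Qed.

Lemma A_left_star b : A_left H b -> A_left H (star H b).
Proof.
case=> phi ->.
pose psi x : C^o := (phi (star H x))^*.
have psi_lin : linear psi.
  move=> k x y; rewrite /psi (star_antilinear (starP H)) linearP /=.
  by rewrite rmorphD rmorphM /= conjCK.
pose psi' : {linear A -> C^o} :=
  HB.pack psi (GRing.isLinear.Build _ _ _ _ psi psi_lin).
exists (linfun psi').
have bB := slicel_balanced A (linfun psi').
rewrite -{2}star1 comul_star (tsum_tsum _ _ bB) raddf_tsum; last exact: starD.
apply: eq_tsum => x y; rewrite (tsum_pure bB) lfunE /= /psi starZ.
by rewrite (star_involutive (starP H)).
Qed.

Lemma comul_A_left' b : A_left H b ->
  Delta b = \tsum_(x, y <- Delta 1) (x * b) \ox y.
Proof.
move=> bL; have sM := star_antimul (starP H).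
have sK := star_involutive (starP H).
rewrite -{1}(sK b) comul_star (comul_A_left (A_left_star bL)).
rewrite (tsum_tsum _ _ star_bal).
have bB : balanced (fun x y : A => (x * b) \ox y).
  split=> [x x' y|x y y'|k x y].
  - by rewrite mulrDl (balDl (pure_balanced _ _)).
  - by rewrite (balDr (pure_balanced _ _)).
  - by rewrite -scalerAl (balZ (pure_balanced _ _)).
rewrite -[in RHS]star1 comul_star (tsum_tsum _ _ bB).
by apply: eq_tsum => x y; rewrite (tsum_pure star_bal) (tsum_pure bB) sM sK.
Qed.

Lemma comul_A_left_mull b a : A_left H b ->
  Delta (b * a) = \tsum_(x, y <- Delta a) (b * x) \ox y.
Proof.
move=> bL; rewrite comulM (comul_A_left bL).
have mb := @mul_bilinear C A.
have -> : \tsum_(x, y <- Delta 1) (b * x) \ox y =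
    tmul *%R *%R (b \ox 1) (Delta 1).
  by rewrite tmul_purel //; apply: eq_tsum => x y; rewrite mul1r.
rewrite -mulAP -comulM mul1r tmul_purel //.
by apply: eq_tsum => x y; rewrite mul1r.
Qed.

Lemma comul_A_left_mulr b a : A_left H b ->
  Delta (a * b) = \tsum_(x, y <- Delta a) (x * b) \ox y.
Proof.
move=> bL; rewrite comulM (comul_A_left' bL).
have mb := @mul_bilinear C A.
have -> : \tsum_(x, y <- Delta 1) (x * b) \ox y =
    tmul *%R *%R (Delta 1) (b \ox 1).
  by rewrite tmul_purer //; apply: eq_tsum => x y; rewrite mulr1.
rewrite mulAP -comulM mulr1 tmul_purer //.
by apply: eq_tsum => x y; rewrite mulr1.
Qed.

Lemma eps_left_in x : A_left H (\tsum_(x1, x2 <- Delta x) x1 * S x2).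
Proof.
exists (linfun (fun u : A => counit H (u * x))).
have l : linear (fun u : A => counit H (u * x)).
  by move=> k u v; rewrite mulrDl -scalerAl linearP.
pose f : {linear A -> C^o} := HB.pack (fun u : A => counit H (u * x))
  (GRing.isLinear.Build _ _ _ _ (fun u : A => counit H (u * x)) l).
by rewrite antipoder; apply: eq_tsum => u v; rewrite (lfunE f).
Qed.

Lemma eps_left_mul x :
  \tsum_(x1, x2 <- Delta x) (\tsum_(p, q <- Delta x1) p * S q) * x2 = x.
Proof.
have mb := @mul_bilinear C A.
have bB := slicel_balanced A (counit H).
transitivity (\tsum_(x1, x2 <- Delta x) \tsum_(u, v <- Delta 1)
    counit H (u * x1) *: (v * x2)).
  apply: eq_tsum => x1 x2; rewrite antipoder.
  rewrite (raddf_tsum (f := *%R^~ x2)) => [|? ?]; last by rewrite mulrDl.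
  by apply: eq_tsum => u v; rewrite -scalerAl.
rewrite exchange_tsum -[RHS](counitl H) -{2}(mul1r x) comulM.
rewrite /tmul (tsum_tsum _ _ bB); apply: eq_tsum => u v.
rewrite (tsum_tsum _ _ bB); apply: eq_tsum => x1 x2.
by rewrite (tsum_pure bB).
Qed.
End Legs.

Section CrossedProduct.
Variables (A : falgType C) (H : weak_Cstar_Hopf A) (M : algType C).
Variable T : module_algebra H M.
Local Notation Delta := (comul H).
Local Notation S := (antipode H).
Local Notation "a |> m" := (act T a m) (at level 40, left associativity).

Definition crossed_mul (s t : tens M A) : tens M A :=
  \tsum_(m, a <- s) \tsum_(m', a' <- t) \tsum_(a1, a2 <- Delta a)
    (m * (a1 |> m')) \ox (a2 * a').

(* M (x)_{A_L} A is the quotient of M (x) A by the span of the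
   m (x) ba - m(b |> 1) (x) a with b in A_L. *)
Definition balancing : set (tens M A) :=
  [set x | exists m b a, A_left H b /\
     x = m \ox (b * a) - (m * (b |> 1)) \ox a].

Definition balancing_span : {pred tens M A} :=
  [pred x | `[< addspan balancing x >]].

Lemma balancing_span_closed : zmod_closed balancing_span.
Proof.
apply: addspan_zmod_closed => _ [m [b [a [bL ->]]]].
exists (- m), b, a; split=> //.
by rewrite mulNr !pureNl opprB opprK addrC.
Qed.

End CrossedProduct.

Section CrossedAlgebra.
Variables (A : falgType C) (H : weak_Cstar_Hopf A) (M : algType C).
Variable T : module_algebra H M.
Local Notation Delta := (comul H).
Local Notation S := (antipode H).
Local Notation "a |> m" := (act T a m) (at level 40, left associativity).
Local Open Scope quotient_scope.

HB.instance Definition _ :=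
  GRing.isZmodClosed.Build (tens M A) (balancing_span T) (balancing_span_closed T).

Definition crossed := Quotient.quot (balancing_span T : zmodClosed (tens M A)).

HB.instance Definition _ := GRing.Zmodule.on crossed.
HB.instance Definition _ := Quotient.on crossed.

Lemma crossed_eqP (s t : tens M A) :
  reflect (\pi_crossed s = \pi_crossed t) (s - t \in balancing_span T).
Proof. by rewrite Quotient.idealrBE; apply: eqP. Qed.

Lemma actDl a b m : (a + b) |> m = a |> m + b |> m.
Proof. by have := act_linearl T m 1 a b; rewrite !scale1r. Qed.

Lemma actDr a m n : a |> (m + n) = a |> m + a |> n.
Proof. by have := act_linearr T a 1 m n; rewrite !scale1r. Qed.

Lemma act0l m : 0 |> m = 0.
Proof. by apply: (addrI (0 |> m)); rewrite -actDl !addr0. Qed.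

Lemma act0r a : a |> 0 = 0.
Proof. by apply: (addrI (a |> 0)); rewrite -actDr !addr0. Qed.

Lemma actZl k a m : (k *: a) |> m = k *: (a |> m).
Proof. by have := act_linearl T m k a 0; rewrite act0l !addr0. Qed.

Lemma actZr k a m : a |> (k *: m) = k *: (a |> m).
Proof. by have := act_linearr T a k m 0; rewrite act0r !addr0. Qed.

Lemma act_A_left b m : A_left H b -> b |> m = (b |> 1) * m.
Proof.
move=> bL.
have bB n p : balanced (fun x y => (x |> n) * (y |> p)).
  split=> [x x' y|x y y'|k x y]; first by rewrite actDl mulrDl.
    by rewrite actDl mulrDr.
  by rewrite !actZl -scalerAl -scalerAr.
rewrite -{1}(mul1r m) actM (comul_A_left' bL) (tsum_tsum _ _ (bB _ _)).
rewrite -[RHS](act1 T) actM; apply: eq_tsum => x y.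
by rewrite (tsum_pure (bB _ _)) actA.
Qed.

Let crossed_in_bal (m m' : M) (a' : A) :
  balanced (fun a1 a2 => (m * (a1 |> m')) \ox (a2 * a')).
Proof.
split=> [x x' y|x y y'|k x y].
- by rewrite actDl mulrDr (balDl (pure_balanced _ _)).
- by rewrite mulrDl (balDr (pure_balanced _ _)).
- by rewrite actZl -scalerAr -scalerAl (balZ (pure_balanced _ _)).
Qed.

Let crossed_mul_balr (m : M) (a : A) :
  balanced (fun m' a' => \tsum_(a1, a2 <- Delta a)
    (m * (a1 |> m')) \ox (a2 * a')).
Proof.
split=> [x x' y|x y y'|k x y].
- by apply: tsumDf => *; rewrite actDr mulrDr (balDl (pure_balanced _ _)).
- by apply: tsumDf => *; rewrite mulrDr (balDr (pure_balanced _ _)).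
- apply: eq_tsum => ? ?; rewrite actZr -!scalerAr (balZ (pure_balanced _ _)).
  reflexivity.
Qed.

Let crossed_mul_ball (t : tens M A) :
  balanced (fun m a => \tsum_(m', a' <- t) \tsum_(a1, a2 <- Delta a)
    (m * (a1 |> m')) \ox (a2 * a')).
Proof.
split=> [x x' y|x y y'|k x y].
- by do 2!apply: tsumDf => ? ?; rewrite mulrDl (balDl (pure_balanced _ _)).
- by apply: tsumDf => ? ?; rewrite linearD tsumD.
- apply: eq_tsum => m' a'; rewrite linearZ /tsum; apply: eq_bigr => i _.
  by rewrite ffunE actZl -scalerAl -scalerAr.
Qed.

Lemma crossed_mulDl : left_distributive (crossed_mul T) +%R.
Proof. by move=> r s t; rewrite /crossed_mul tsumD. Qed.

Lemma crossed_mulDr : right_distributive (crossed_mul T) +%R.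
Proof. by move=> r s t; apply: tsumDf => m a; rewrite tsumD. Qed.

Lemma crossed_mul_pure m a m' a' :
  crossed_mul T (m \ox a) (m' \ox a') =
  \tsum_(a1, a2 <- Delta a) (m * (a1 |> m')) \ox (a2 * a').
Proof. by rewrite /crossed_mul tsum_pure // tsum_pure. Qed.

Lemma crossed_mul_pureA m a m' a' m'' a'' :
  crossed_mul T (m \ox a) (crossed_mul T (m' \ox a') (m'' \ox a'')) =
  crossed_mul T (crossed_mul T (m \ox a) (m' \ox a')) (m'' \ox a'').
Proof.
pose F b c := \tsum_(a1, a2 <- Delta a) \tsum_(p, q <- Delta a1)
   (m * (p |> m') * (q |> (b |> m''))) \ox (a2 * (c * a'')).
transitivity (\tsum_(b, c <- Delta a') F b c).
  rewrite (crossed_mul_pure m') (raddf_tsum (f := crossed_mul T (m \ox a)));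
    last exact: crossed_mulDr.
  apply: eq_tsum => b c; rewrite crossed_mul_pure; apply: eq_tsum => a1 a2.
  rewrite actM (raddf_tsum (f := fun n => (m * n) \ox (a2 * (c * a''))));
    last by move=> x y; rewrite mulrDr (balDl (pure_balanced _ _)).
  by apply: eq_tsum => p q; rewrite !mulrA.
rewrite crossed_mul_pure.
rewrite (raddf_tsum (f := fun s => crossed_mul T s (m'' \ox a'')));
  last by move=> x y; apply: crossed_mulDl.
transitivity (\tsum_(a1, a2 <- Delta a) \tsum_(p, q <- Delta a2)
    \tsum_(b, c <- Delta a')
      (m * (a1 |> m') * ((p * b) |> m'')) \ox (q * c * a'')); last first.
  apply: eq_tsum => a1 a2; rewrite crossed_mul_pure comulM /tmul.
  rewrite (tsum_tsum _ _ (crossed_in_bal _ _ _)); apply: eq_tsum => p q.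
  rewrite (tsum_tsum _ _ (crossed_in_bal _ _ _)); apply: eq_tsum => b c.
  by rewrite (tsum_pure (crossed_in_bal _ _ _)).
under [RHS]eq_tsum do rewrite exchange_tsum.
rewrite [RHS]exchange_tsum; apply: eq_tsum => b c; rewrite /F.
rewrite comul_coassoc.
  by apply: eq_tsum => a1 a2; apply: eq_tsum => p q; rewrite actA !mulrA.
split=> [x x' y z|x y y' z|x y z z'|k x y z|k x y z].
- by rewrite actDl mulrDr mulrDl (balDl (pure_balanced _ _)).
- by rewrite actDl mulrDr (balDl (pure_balanced _ _)).
- by rewrite mulrDl (balDr (pure_balanced _ _)).
- by rewrite !actZl -!scalerAr -scalerAl.
- by rewrite !actZl -scalerAr -!scalerAl (balZ (pure_balanced _ _)).
Qed.

Lemma crossed_mulA : associative (crossed_mul T).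
Proof.
move=> r s t; have Dl := crossed_mulDl; have Dr := crossed_mulDr.
pose mu := crossed_mul T; rewrite -/mu.
apply: (tens_ext (f := fun r => mu r (mu s t)) (g := fun r => mu (mu r s) t)).
- by move=> x y /=; rewrite /mu Dl.
- by move=> x y /=; rewrite /mu !Dl.
move=> u v; apply: (tens_ext (f := fun s => mu (u \ox v) (mu s t))
  (g := fun s => mu (mu (u \ox v) s) t)).
- by move=> x y /=; rewrite /mu Dl Dr.
- by move=> x y /=; rewrite /mu Dr Dl.
move=> u' v'; apply: (tens_ext (f := fun t => mu (u \ox v) (mu (u' \ox v') t))
  (g := fun t => mu (mu (u \ox v) (u' \ox v')) t)).
- by move=> x y /=; rewrite /mu !Dr.
- by move=> x y /=; rewrite /mu Dr.
move=> u'' v''; exact: crossed_mul_pureA.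
Qed.

Lemma balancing_in m b a : A_left H b ->
  m \ox (b * a) - (m * (b |> 1)) \ox a \in balancing_span T.
Proof.
move=> bL; apply/asboolP; exists [:: m \ox (b * a) - (m * (b |> 1)) \ox a].
  by move=> y; rewrite inE => /eqP ->; exists m, b, a.
by rewrite big_seq1.
Qed.

Lemma balancing_span_ind (P : tens M A -> Prop) :
  P 0 -> (forall s t, P s -> P t -> P (s + t)) ->
  (forall m b a, A_left H b -> P (m \ox (b * a) - (m * (b |> 1)) \ox a)) ->
  forall s, s \in balancing_span T -> P s.
Proof.
move=> P0 PD Pp s /asboolP[r rP ->]; rewrite big_seq.
by elim/big_ind: _ => // y /rP[m [b [a [bL ->]]]]; apply: Pp.
Qed.

Lemma balancing_tsum (W : lmodType C) (V : vectType C)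
    (B : W -> V -> tens M A) t :
  (forall u v, B u v \in balancing_span T) ->
  tsum B t \in balancing_span T.
Proof. by move=> BN; apply: rpred_sum => i _; apply: BN. Qed.

Lemma crossed_mul_idealr s t :
  s \in balancing_span T -> crossed_mul T s t \in balancing_span T.
Proof.
move: s; apply: balancing_span_ind => [|s s' sN s'N|m b a bL].
- by rewrite /crossed_mul tsum0 ?rpred0.
- by rewrite crossed_mulDl rpredD.
suff -> : crossed_mul T (m \ox (b * a) - (m * (b |> 1)) \ox a) t = 0.
  exact: rpred0.
rewrite /crossed_mul tsumD // tsumN // !tsum_pure //; apply/eqP.
rewrite subr_eq0; apply/eqP; apply: eq_tsum => m' a'.
rewrite (comul_A_left_mull _ bL) tsum_tsum //.
apply: eq_tsum => a1 a2; rewrite tsum_pure // actA (act_A_left _ bL).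
by rewrite mulrA.
Qed.

Lemma crossed_mul_ideall s t :
  t \in balancing_span T -> crossed_mul T s t \in balancing_span T.
Proof.
move: t; apply: balancing_span_ind => [|t t' tN t'N|m' b a' bL].
- suff -> : crossed_mul T s 0 = 0 by exact: rpred0.
  by apply: (addrI (crossed_mul T s 0)); rewrite -crossed_mulDr !addr0.
- by rewrite crossed_mulDr rpredD.
apply: balancing_tsum => m a.
rewrite tsumD // tsumN // !tsum_pure //.
set x := tsum _ _; set y := tsum _ _.
pose F n c := n \ox (c * (b * a')) -
  \tsum_(c1, c2 <- Delta c) (n * ((c1 * b) |> 1)) \ox (c2 * a').
have -> : x - y = \tsum_(a1, a2 <- Delta a) F (m * (a1 |> m')) a2.
  rewrite /F; transitivity (x - \tsum_(a1, a2 <- Delta a)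
    \tsum_(c1, c2 <- Delta a2) (m * (a1 |> m') * ((c1 * b) |> 1)) \ox (c2 * a')).
    congr (_ - _); rewrite -comul_coassoc /y.
      apply: eq_tsum => a1 a2.
      rewrite actM (raddf_tsum (f := fun n => (m * n) \ox (a2 * a')));
        last by move=> p q; rewrite mulrDr (balDl (pure_balanced _ _)).
      by apply: eq_tsum => p q; rewrite mulrA actA.
    split=> [p p' q r|p q q' r|p q r r'|k p q r|k p q r].
    - by rewrite actDl mulrDr mulrDl (balDl (pure_balanced _ _)).
    - by rewrite mulrDl actDl mulrDr (balDl (pure_balanced _ _)).
    - by rewrite mulrDl (balDr (pure_balanced _ _)).
    - by rewrite -scalerAl !actZl -!scalerAr -scalerAl.
    - by rewrite !actZl -scalerAr -!scalerAl (balZ (pure_balanced _ _)).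
  apply/eqP; rewrite subr_eq; apply/eqP; apply: tsumDf => a1 a2.
  by rewrite subrK.
apply: balancing_tsum => a1 c; rewrite /F; move: (m * _) => n.
rewrite mulrA -(eps_left_mul H (c * b)) (comul_A_left_mulr _ bL).
have bB : balanced (fun x1 x2 : A =>
    (\tsum_(p, q <- Delta x1) p * S q) * x2).
  have bS : balanced (fun p q : A => p * S q).
    split=> [p p' q|p q q'|k p q]; first by rewrite mulrDl.
      by rewrite linearD mulrDr.
    by rewrite linearZ -scalerAl -scalerAr.
  split=> [p p' q|p q q'|k p q]; first by rewrite linearD tsumD // mulrDl.
    by rewrite mulrDr.
  rewrite linearZ tsumZ => [|l u v]; last by rewrite -scalerAl.
  by rewrite -scalerAl -scalerAr.
rewrite (tsum_tsum _ _ bB).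
rewrite (raddf_tsum (f := fun v => n \ox (v * a'))) => [|p q]; last first.
  by rewrite mulrDl (balDr (pure_balanced _ _)).
rewrite [X in X \in _](_ : _ = \tsum_(c1, c2 <- Delta c)
  ((n \ox ((\tsum_(p, q <- Delta (c1 * b)) p * S q) * (c2 * a'))) -
   (n * ((\tsum_(p, q <- Delta (c1 * b)) p * S q) |> 1)) \ox (c2 * a'))).
  by apply: balancing_tsum => c1 c2; apply: balancing_in; apply: eps_left_in.
apply/eqP; rewrite subr_eq; apply/eqP; apply: tsumDf => c1 c2.
by rewrite (tsum_pure bB) -act_one subrK mulrA.
Qed.

Lemma comul1_A_left : exists2 y : 'I_(\dim {:A}) -> A,
  (forall i, A_left H (y i)) & Delta 1 = \sum_(i < \dim {:A}) (vbasis {:A})`_i \ox y i.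
Proof.
exists (fun i => \tsum_(u, v <- Delta 1) dual_basis i u *: v).
  by move=> i; exists (dual_basis i).
rewrite [LHS]tens_sum /tsum.
transitivity (\sum_(k < \dim {:A}) \sum_(i < \dim {:A})
   (vbasis {:A})`_i \ox (dual_basis i (Delta 1 k) *: (vbasis {:A})`_k)).
  apply: eq_bigr => k _; rewrite {1}(coord_vbasis (memvf (Delta 1 k))).
  have bP := @pure_balanced C A A.
  rewrite (big_morph (fun u : A => u \ox (vbasis {:A})`_k)
             (fun u v => balDl bP u v _) (bal0l bP _)).
  by apply: eq_bigr => i _; rewrite (balZ bP) dual_basisE.
rewrite exchange_big; apply: eq_bigr => i _ /=.
have bP := @pure_balanced C A A.
by rewrite (big_morph _ (balDr bP _) (bal0r bP _)).
Qed.

Lemma crossed_mul1l s : crossed_mul T (1 \ox 1) s - s \in balancing_span T.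
Proof.
pose f s := crossed_mul T (1 \ox 1) s - s.
have fD : {morph f : x y / x + y}.
  by move=> x y; rewrite /f crossed_mulDr opprD addrACA.
rewrite -/(f s) [s]tens_sum (raddf_tsum _ _ fD).
apply: balancing_tsum => m a; rewrite /f crossed_mul_pure.
have bB : balanced (fun x y : A => (1 * (x |> m)) \ox (y * a)).
  exact: crossed_in_bal.
have [y yL E] := comul1_A_left.
have mE : m = \sum_(i < \dim {:A}) ((vbasis {:A})`_i |> m) * (y i |> 1).
  rewrite -{1}(mulr1 m) -{1}(act1 T (m * 1)) actM E tsum_bigsum.
    apply: eq_bigr => i _; rewrite tsum_pure //.
    split=> [x x' z|x z z'|k x z]; first by rewrite actDl mulrDl.
      by rewrite actDl mulrDr.
    by rewrite !actZl -scalerAl -scalerAr.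
  split=> [x x' z|x z z'|k x z]; first by rewrite actDl mulrDl.
    by rewrite actDl mulrDr.
  by rewrite !actZl -scalerAl -scalerAr.
rewrite {2}mE E tsum_bigsum //.
have bP := @pure_balanced C M A.
rewrite (big_morph (fun u : M => u \ox a)
           (fun u v => balDl bP u v _) (bal0l bP _)) -sumrB.
apply: rpred_sum => i _; rewrite tsum_pure // mul1r.
exact: balancing_in.
Qed.

Lemma crossed_mul1r s : crossed_mul T s (1 \ox 1) - s \in balancing_span T.
Proof.
pose f s := crossed_mul T s (1 \ox 1) - s.
have fD : {morph f : x y / x + y}.
  by move=> x y; rewrite /f crossed_mulDl opprD addrACA.
rewrite -/(f s) [s]tens_sum (raddf_tsum _ _ fD).
apply: balancing_tsum => m a; rewrite /f crossed_mul_pure -rpredN opprB.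
rewrite -{1}(eps_left_mul H a).
rewrite (raddf_tsum (f := fun v => m \ox v)) => [|p q]; last first.
  by rewrite (balDr (pure_balanced _ _)).
rewrite [X in X \in _](_ : _ = \tsum_(c1, c2 <- Delta a)
  ((m \ox ((\tsum_(p, q <- Delta c1) p * S q) * c2)) -
   (m * ((\tsum_(p, q <- Delta c1) p * S q) |> 1)) \ox c2)).
  by apply: balancing_tsum => c1 c2; apply: balancing_in; apply: eps_left_in.
apply/eqP; rewrite subr_eq; apply/eqP; apply: tsumDf => c1 c2.
by rewrite mulr1 -act_one subrK.
Qed.

(* Independent of the representatives: see [pi_crossed_mul] and [rtimesM]. *)
Definition crossed_prod (x y : crossed) : crossed :=
  \pi_crossed (crossed_mul T (repr x) (repr y)).

Lemma pi_crossed_mul s t :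
  crossed_prod (\pi_crossed s) (\pi_crossed t) = \pi_crossed (crossed_mul T s t).
Proof.
apply/crossed_eqP; set s' := repr _; set t' := repr _.
have sN : s' - s \in balancing_span T by apply/crossed_eqP; rewrite reprK.
have tN : t' - t \in balancing_span T by apply/crossed_eqP; rewrite reprK.
rewrite -(subrKA (crossed_mul T s' t)) rpredD //.
  rewrite (_ : _ - _ = crossed_mul T s' (t' - t)); last first.
    by apply/eqP; rewrite subr_eq -crossed_mulDr subrK.
  exact: crossed_mul_ideall.
rewrite (_ : _ - _ = crossed_mul T (s' - s) t); last first.
  by apply/eqP; rewrite subr_eq -crossed_mulDl subrK.
exact: crossed_mul_idealr.
Qed.

Lemma crossed_prodA : associative crossed_prod.
Proof.
move=> x y z; rewrite -[x]reprK -[y]reprK -[z]reprK.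
move: (repr x) (repr y) (repr z) => r s t; rewrite (pi_crossed_mul s t).
by rewrite (pi_crossed_mul r s) !pi_crossed_mul crossed_mulA.
Qed.

Lemma crossed_prod1l : left_id (\pi_crossed (1 \ox 1)) crossed_prod.
Proof.
by move=> x; rewrite -[x]reprK pi_crossed_mul; apply/crossed_eqP/crossed_mul1l.
Qed.

Lemma crossed_prod1r : right_id (\pi_crossed (1 \ox 1)) crossed_prod.
Proof.
by move=> x; rewrite -[x]reprK pi_crossed_mul; apply/crossed_eqP/crossed_mul1r.
Qed.

Lemma pi_crossedD s t :
  \pi_crossed (s + t) = \pi_crossed s + \pi_crossed t :> crossed.
Proof. exact: pi_addr. Qed.

Lemma crossed_prodDl : left_distributive crossed_prod +%R.
Proof.
move=> x y z; rewrite -[x]reprK -[y]reprK -[z]reprK.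
move: (repr x) (repr y) (repr z) => r s t.
by rewrite -pi_crossedD !pi_crossed_mul crossed_mulDl pi_crossedD.
Qed.

Lemma crossed_prodDr : right_distributive crossed_prod +%R.
Proof.
move=> x y z; rewrite -[x]reprK -[y]reprK -[z]reprK.
move: (repr x) (repr y) (repr z) => r s t.
by rewrite -pi_crossedD !pi_crossed_mul crossed_mulDr pi_crossedD.
Qed.

HB.instance Definition _ := GRing.Zmodule_isPzRing.Build crossed
  crossed_prodA crossed_prod1l crossed_prod1r crossed_prodDl crossed_prodDr.

Definition rtimes (m : M) (a : A) : crossed := \pi_crossed (m \ox a).

Lemma rtimesM m a m' a' :
  rtimes m a * rtimes m' a' =
  \tsum_(a1, a2 <- Delta a) rtimes (m * (a1 |> m')) (a2 * a').
Proof.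
rewrite [LHS]pi_crossed_mul crossed_mul_pure.
by rewrite (raddf_tsum (f := \pi_crossed)) //; apply: pi_crossedD.
Qed.

Lemma rtimes_A_left m b a : A_left H b -> rtimes m (b * a) = rtimes (m * (b |> 1)) a.
Proof. by move=> bL; apply/crossed_eqP; apply: balancing_in. Qed.

(* Independent of the representative: see [Ehat_pi] and [Ehat_rtimes]. *)
Definition Ehat (lambda : dual A) (x : crossed) : M :=
  \tsum_(m, a <- repr x) m * (harpoon H lambda a |> 1).

Let harpoonD lambda : {morph harpoon H lambda : a b / a + b}.
Proof.
move=> a b; rewrite /harpoon linearD tsumD //; exact: slicer_balanced.
Qed.

Let harpoonZ lambda k a : harpoon H lambda (k *: a) = k *: harpoon H lambda a.
Proof.
by rewrite /harpoon linearZ tsumZ // => l x y; rewrite !scalerA mulrC.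
Qed.

Let Ehat_bal lambda :
  balanced (fun m a => m * (harpoon H lambda a |> 1)).
Proof.
split=> [x x' z|x z z'|k x z]; first by rewrite mulrDl.
  by rewrite harpoonD actDl mulrDr.
by rewrite harpoonZ actZl -scalerAl -scalerAr.
Qed.

Lemma Ehat_pi lambda s :
  Ehat lambda (\pi_crossed s) = \tsum_(m, a <- s) m * (harpoon H lambda a |> 1).
Proof.
pose f := tsum (fun m a => m * (harpoon H lambda a |> 1)).
have fD : {morph f : x y / x + y} := tsumD (Ehat_bal lambda).
suff f0 r : r \in balancing_span T -> f r = 0.
  rewrite /Ehat -/(f _) -/(f _); set s' := repr _.
  apply/eqP; rewrite -subr_eq0 -[- f s]tsumN // -fD f0 //.
  by apply/crossed_eqP; rewrite reprK.
move: r; apply: balancing_span_ind => [|r r' r0 r'0|m b a bL].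
- exact: tsum0.
- by rewrite fD r0 r'0 addr0.
rewrite fD [f (- _)]tsumN // /f !tsum_pure //.
rewrite -mulrA -act_A_left // -actA (_ : harpoon H lambda (b * a) =
   b * harpoon H lambda a) ?subrr //.
have bS := slicer_balanced A lambda.
rewrite /harpoon (comul_A_left_mull _ bL) (tsum_tsum _ _ bS).
rewrite (raddf_tsum (f := *%R b)) => [|? ?]; last exact: mulrDr.
by apply: eq_tsum => x y; rewrite (tsum_pure bS) scalerAr.
Qed.

Lemma Ehat_rtimes lambda m a :
  Ehat lambda (rtimes m a) = m * (harpoon H lambda a |> 1).
Proof. by rewrite Ehat_pi tsum_pure. Qed.

Lemma EhatD lambda : {morph Ehat lambda : x y / x + y}.
Proof.
move=> x y; rewrite -[x]reprK -[y]reprK -pi_crossedD !Ehat_pi.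
by rewrite tsumD.
Qed.

Lemma dual_mul_bal (psi phi : dual A) :
  balanced (fun x y => psi x * phi y : C^o).
Proof.
split=> [x x' y|x y y'|k x y]; first by rewrite linearD mulrDl.
  by rewrite linearD mulrDr.
by rewrite !linearZ /= -scalerAl -scalerAr.
Qed.

Lemma dual_mulE (psi phi : dual A) x :
  dual_mul H psi phi x = \tsum_(x1, x2 <- Delta x) psi x1 * phi x2.
Proof.
have bB := dual_mul_bal psi phi.
pose f x : C^o := \tsum_(x1, x2 <- Delta x) psi x1 * phi x2.
have l : linear f.
  move=> k u v; rewrite /f linearP tsumD //; congr (_ + _).
  by rewrite tsumZ // => c y z; rewrite linearZ /= scalerAl.
pose g : {linear A -> C^o} := HB.pack f (GRing.isLinear.Build _ _ _ _ f l).
exact: (lfunE g).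
Qed.

Lemma dual_comulE (psi : dual A) x y :
  tsum (fun psi1 psi2 : dual A => psi1 x * psi2 y) (dual_comul psi) =
  psi (x * y).
Proof.
pose f y : dual A := linfun (fun x => psi (x * y)).
have fE u v : f u v = psi (v * u).
  have l : linear (fun x => psi (x * u)).
    by move=> k a b; rewrite mulrDl -scalerAl linearP.
  pose g : {linear A -> C^o} := HB.pack (fun x => psi (x * u))
    (GRing.isLinear.Build _ _ _ _ (fun x => psi (x * u)) l).
  exact: (lfunE g).
have fl : linear f.
  move=> k u v; apply/lfunP => a; rewrite !lfunE /= fE lfunE /= !fE.
  by rewrite mulrDr -scalerAr linearP.
rewrite -fE -(tens_of_mapK fl y) /tens_eval.
rewrite (raddf_tsum (f := fun g : dual A => g x)) => [|g g']; last first.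
  by rewrite lfunE.
by apply: eq_tsum => p q; rewrite lfunE /= [RHS]mulrC.
Qed.

Definition center : set M := [set z | forall m, z * m = m * z].

Definition commutant : set crossed :=
  [set x | forall m, rtimes m 1 * x = x * rtimes m 1].

Definition one_rtimes_A_right : set crossed :=
  [set rtimes 1 a | a in A_right H].

Definition center_rtimes_A_right : set crossed :=
  addspan [set x | exists z a, [/\ center z, A_right H a & x = rtimes z a]].

(* The map M -> M (x) A^ with a |> m = (id (x) a)(coaction m). *)
Definition coaction (m : M) : tens M (dual A) := tens_of_map (fun a => a |> m).

Lemma coactionE m a : tens_eval (coaction m) a = a |> m.
Proof. by apply: tens_of_mapK; apply: act_linearl. Qed.

Definition impl_mul : tens M (dual A) -> tens M (dual A) -> tens M (dual A) :=
  tmul *%R (dual_mul H).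

(* [implementersE] rephrases this for the map a |-> tens_eval t a. *)
Definition implementers : set (tens M (dual A)) :=
  [set t | forall m, impl_mul t (m \ox counit H) = impl_mul (coaction m) t].

Definition trivial_implementers : set (tens M (dual A)) :=
  [set impl_mul (coaction 1) (1 \ox lambda) | lambda in left_integral H].

Definition implZ (z : M) (t : tens M (dual A)) : tens M (dual A) :=
  \tsum_(m, phi <- t) (z * m) \ox phi.

Definition outer : Prop :=
  implementers =
  addspan [set x | exists z t,
    [/\ center z, trivial_implementers t & x = implZ z t]].

(* t_x, as the element of M (x) A^ with t_x(a) = E(a x): see [t_implE]. *)
Definition t_impl (lambda : dual A) (x : crossed) : tens M (dual A) :=
  tens_of_map (fun a => Ehat lambda (rtimes 1 a * x)).

Lemma dual_mul_bilinear : bilinear_map (dual_mul H).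
Proof.
split=> [u u' v|u v v'|k u v|k u v]; apply/lfunP => a;
  rewrite ?lfunE /= !dual_mulE.
- by apply: tsumDf => x y; rewrite lfunE /= mulrDl.
- by apply: tsumDf => x y; rewrite lfunE /= mulrDr.
- rewrite (raddf_tsum (f := *:%R k)) => [|? ?]; last exact: scalerDr.
  by apply: eq_tsum => x y; rewrite lfunE /= scalerAl.
- rewrite (raddf_tsum (f := *:%R k)) => [|? ?]; last exact: scalerDr.
  by apply: eq_tsum => x y; rewrite lfunE /= scalerAr.
Qed.

Lemma tens_eval_pure (m : M) (phi : dual A) a :
  tens_eval (m \ox phi) a = (phi a : C) *: m.
Proof. by rewrite /tens_eval tsum_pure //; apply: eval_balanced. Qed.

Lemma tens_evalD (a : A) :
  {morph (fun t : tens M (dual A) => tens_eval t a) : s t / s + t}.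
Proof. by apply: tsumD; apply: eval_balanced. Qed.

(* Under the identification with maps A -> M the product is convolution. *)
Lemma eval_impl_mul s t a :
  tens_eval (impl_mul s t) a =
  \tsum_(a1, a2 <- Delta a) tens_eval s a1 * tens_eval t a2.
Proof.
have [Dl Dr _ _] := tmul_bilinear (@mul_bilinear C M) dual_mul_bilinear.
pose f (s t : tens M (dual A)) : M := tens_eval (impl_mul s t) a.
pose g (s t : tens M (dual A)) : M := \tsum_(a1, a2 <- Delta a) tens_eval s a1 * tens_eval t a2.
rewrite -/(f s t) -/(g s t).
apply: (tens_ext (f := f^~ t) (g := g^~ t)).
- by move=> x y; rewrite /f /impl_mul Dl tens_evalD.
- by move=> x y; apply: tsumDf => ? ?; rewrite tens_evalD mulrDl.
move=> m phi; apply: (tens_ext (f := f (m \ox phi)) (g := g (m \ox phi))).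
- by move=> x y; rewrite /f /impl_mul Dr tens_evalD.
- by move=> x y; apply: tsumDf => ? ?; rewrite tens_evalD mulrDr.
move=> n psi; rewrite /f /g /impl_mul tmul_pure //; last 2 first.
- exact: mul_bilinear.
- exact: dual_mul_bilinear.
rewrite tens_eval_pure dual_mulE (raddf_tsum (f := fun c : C^o => (c : C) *: (m * n))) => [|? ?];
  last by rewrite scalerDl.
apply: eq_tsum => x y; rewrite !tens_eval_pure.
by rewrite -scalerAl -scalerAr scalerA.
Qed.

Lemma implementersE t :
  implementers t <-> forall a m,
    tens_eval t a * m = \tsum_(a1, a2 <- Delta a) (a1 |> m) * tens_eval t a2.
Proof.
have L a m : tens_eval (impl_mul t (m \ox counit H)) a = tens_eval t a * m.
  rewrite eval_impl_mul -{2}(counitr H a).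
  rewrite (raddf_tsum (f := tens_eval t)) => [|x y]; last first.
    by apply: tsumDf => ? ?; rewrite linearD scalerDl.
  rewrite (raddf_tsum (f := *%R^~ m)) => [|? ?]; last by rewrite mulrDl.
  apply: eq_tsum => x y; rewrite tens_eval_pure -scalerAr.
  rewrite [tens_eval t (_ *: _)](_ : _ = counit H y *: tens_eval t x) ?scalerAl //.
  rewrite /tens_eval (raddf_tsum (f := *:%R _)) => [|? ?]; last exact: scalerDr.
  by apply: eq_tsum => ? ?; rewrite linearZ /= scalerA.
have Rr a m : tens_eval (impl_mul (coaction m) t) a =
    \tsum_(a1, a2 <- Delta a) (a1 |> m) * tens_eval t a2.
  by rewrite eval_impl_mul; apply: eq_tsum => x y; rewrite coactionE.
split=> [h a m|h m]; first by rewrite -L h Rr.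
rewrite -[LHS]tens_evalK -[RHS]tens_evalK; apply: eq_bigr => i _.
by rewrite L Rr h.
Qed.

Lemma implZE z t a : tens_eval (implZ z t) a = z * tens_eval t a.
Proof.
rewrite /implZ (raddf_tsum (f := fun t => tens_eval t a)); last exact: tens_evalD.
rewrite /tens_eval (raddf_tsum (f := *%R z)) => [|? ?]; last exact: mulrDr.
by apply: eq_tsum => m phi; rewrite -/(tens_eval _ _) tens_eval_pure scalerAr.
Qed.

Lemma t_implE lambda x a :
  tens_eval (t_impl lambda x) a = Ehat lambda (rtimes 1 a * x).
Proof.
apply: (tens_of_mapK (f := fun a => Ehat lambda (rtimes 1 a * x))) => k u v.
have pB := @pure_balanced C M A.
have -> : rtimes 1 (k *: u + v) = rtimes 1 (k *: u) + rtimes 1 v.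
  by rewrite /rtimes (balDr pB) pi_crossedD.
rewrite mulrDl EhatD; congr (_ + _).
rewrite -[x]reprK; move: (repr x) => s.
rewrite -[X in Ehat _ X]/(crossed_prod _ _) -[X in _ *: Ehat _ X]/(crossed_prod _ _).
rewrite !pi_crossed_mul !Ehat_pi.
rewrite -tsumZ => [|l m a']; last by rewrite -scalerAl.
congr tsum; rewrite /crossed_mul.
rewrite (tsum_pure (crossed_mul_ball _)) (tsum_pure (crossed_mul_ball _)).
rewrite (raddf_tsum (f := *:%R k)) => [|? ?]; last exact: scalerDr.
apply: eq_tsum => m b; rewrite linearZ tsumZ // => l y z.
by rewrite mul1r actZl mul1r pureZl.
Qed.

End CrossedAlgebra.
End WeakHopf.

Arguments commutant {C A H M} T _.
Arguments one_rtimes_A_right {C A H M} T _.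
Arguments center_rtimes_A_right {C A H M} T _.
Arguments Ehat {C A H M} T lambda x.
Arguments t_impl {C A H M} T lambda x.

(* Main.v *)
(* The Haar integral satisfies h_1 b (x) h_2 = h_1 (x) h_2 S(b).  Slicing with
   lambda shows that S is injective, hence onto, so that also
   S(h_1) (x) h_2 a = a S(h_1) (x) h_2, and (S(h_1), h_2) is a quasi-basis:
   S(h_1) (lambda -> h_2 a) = a.  By the nondegeneracy of lambda the other-sided
   identity (lambda -> a S(h_1)) h_2 = a holds as well.  In the crossed product
   S(a_1) (a_2 |> m) = m S(a), so the first identity extends to
   x = S(h_1) E(h_2 x): hence t is injective, and T |-> S(h_1) T(h_2) is its
   inverse by the second identity.  For a left integral phi the same element
   S(h_1) (phi -> h_2) lies in A_R and is mapped to the trivial implementer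
   of phi. *)

Require Import Defs.
From HB Require Import structures.
From mathcomp Require Import all_boot all_order all_algebra all_field.
From mathcomp Require Import complex boolp classical_sets functions reals.

Set Implicit Arguments.
Unset Strict Implicit.
Unset Printing Implicit Defensive.

Import Order.TTheory GRing.Theory Num.Theory.

Local Open Scope classical_set_scope.
Local Open Scope ring_scope.

(** * Tensor sums and bilinearity *)

Lemma tsumZl (K : fieldType) (U : lmodType K) (V : vectType K) (W : zmodType)
    (B : U -> V -> W) k t :
  tsum B (k *: t) = \tsum_(u, v <- t) B (k *: u) v.
Proof. by apply: eq_bigr => i _; rewrite ffunE. Qed.

(** The stored component of index i is the slice of Delta(1) by the i-th dual basis vector. *)
Lemma tens_comul1_right (C : numClosedFieldType) (A : falgType C)
  (H : weak_Cstar_Hopf A) (i : 'I_(\dim {:A})) : A_right H (comul H 1 i).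
Proof.
exists (dual_basis i); rewrite /tsum (bigD1 i) //= big1 ?addr0 => [|j ij].
  by rewrite dual_basisE coord_free ?(basis_free (vbasisP _)) // eqxx scale1r.
rewrite dual_basisE coord_free ?(basis_free (vbasisP _)) //.
by rewrite (negbTE ij) scale0r.
Qed.

Section Bilinearity.
Variables (C : numClosedFieldType) (A : falgType C).

Lemma dualZ (phi : dual A) k x : phi (k *: x) = k * phi x :> C.
Proof. by rewrite linearZ. Qed.

Lemma dualD (phi : dual A) x y : phi (x + y) = phi x + phi y :> C.
Proof. by rewrite linearD. Qed.

Lemma pureDl (U : lmodType C) (V : vectType C) (u u' : U) (v : V) :
  (u + u') \ox v = u \ox v + u' \ox v.
Proof. exact: (balDl (pure_balanced _ _)). Qed.

Lemma pureDr (U : lmodType C) (V : vectType C) (u : U) (v v' : V) :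
  u \ox (v + v') = u \ox v + u \ox v'.
Proof. exact: (balDr (pure_balanced _ _)). Qed.

End Bilinearity.

Ltac leafD :=
  rewrite ?(pureDl, pureDr, dualD, linearD, mulrDl, mulrDr, scalerDl, scalerDr);
  reflexivity.
Ltac leafZ :=
  rewrite ?(pureZl, pureZr, dualZ, linearZ) /=
    -?(scalerAl, scalerAr) ?(pureZl, pureZr, linearZ) /=
    -?(scalerAl, scalerAr) ?(pureZl, pureZr, linearZ) /=
    ?scalerA ?mulrA;
  do ?[reflexivity | by rewrite mulrC | congr (_ *: _); by rewrite mulrC
    | by rewrite mulrAC].
(* Pushes sums and scalars through nested Sweedler sums, the coproducts of the
   legs included. *)
Ltac bal :=
  lazymatch goal with
  | |- balanced _ => split=> [? ? ?|? ? ?|? ? ?]; bal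
  | |- trilinear_map _ =>
      split=> [? ? ? ?|? ? ? ?|? ? ? ?|? ? ? ?|? ? ? ?]; bal
  | |- tsum _ ?s = tsum _ ?s + tsum _ ?s => apply: tsumDf => ? ?; bal
  | |- tsum _ _ = tsum _ _ + tsum _ _ => rewrite linearD tsumD; [reflexivity|bal]
  | |- tsum _ ?s = tsum _ ?s => apply: eq_tsum => ? ?; bal
  | |- tsum _ _ = tsum _ _ => rewrite linearZ tsumZl; apply: eq_tsum => ? ?; bal
  | |- _ = _ + _ => leafD
  | |- _ = _ => leafZ
  end.

(** * Weak Hopf algebras *)

Section WeakHopfAlgebra.
Variables (C : numClosedFieldType) (A : falgType C) (H : weak_Cstar_Hopf A).
Local Notation Delta := (comul H).
Local Notation S := (antipode H).
Local Notation eps := (counit H).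
Implicit Types (a b l r x y z : A).

Let mb := @mul_bilinear C A.

(** The family that stores Delta(1) has its entries in A_R, so the two sums can be compared term by
    term. *)
Lemma eq_tsum_comul1 (W : zmodType) (B B' : A -> A -> W) :
  (forall r y, A_right H r -> B r y = B' r y) ->
  tsum B (Delta 1) = tsum B' (Delta 1).
Proof. by move=> e; apply: eq_bigr => i _; apply/e/tens_comul1_right. Qed.

(** Slicing the third leg of the axiom [comul1] with phi turns it into Delta(1) (1 (x) b) =
    Delta(b). *)
Lemma comul_A_right b : A_right H b ->
  Delta b = \tsum_(x, y <- Delta 1) x \ox (y * b).
Proof.
case=> phi bE; have bG := slicer_balanced (tens A A) phi.
have := congr1 (tsum (fun t c => phi c *: t)) (comul1 H).
have bAA := tmul_bilinear mb mb.
have bP : balanced (fun (u : tens A A) v => phi (1 * v) *: tmul *%R *%R (Delta 1) u).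
  split=> [x x' y|x y y'|k x y].
  - by rewrite (bilDr bAA) scalerDr.
  - by rewrite mulrDr dualD scalerDl.
  - by rewrite (bilZr bAA) scalerA -scalerAr dualZ mulrC.
rewrite tmul_purel // (tsum_tsum _ _ bG).
under eq_tsum do rewrite (tsum_pure bG).
rewrite (tsum_tsum _ _ bP); under eq_tsum do rewrite (tsum_pure bP).
rewrite (tsum_tsum _ _ bG); under [X in _ = X]eq_tsum do rewrite (tsum_pure bG).
move=> E; transitivity (\tsum_(x, y <- Delta 1) phi y *: Delta x).
  rewrite [in LHS]bE (raddf_tsum (f := Delta)) => [|x y]; last exact: linearD.
  by apply: eq_tsum => x y; rewrite linearZ.
rewrite -E; transitivity (tmul *%R *%R (Delta 1) (1 \ox b)); last first.
  by rewrite tmul_purer //; apply: eq_tsum => x y; rewrite mulr1.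
rewrite [in RHS]bE (raddf_tsum (f := fun b => tmul *%R *%R (Delta 1) (1 \ox b))).
  by apply: eq_tsum => x y; rewrite mul1r pureZr (bilZr bAA).
by move=> x y; rewrite pureDr (bilDr bAA).
Qed.

Lemma A_right_star b : A_right H b -> A_right H (star H b).
Proof.
case=> phi ->.
(* Delta(1) is self-adjoint, so the star of its slice by phi is its slice by the conjugate
   functional psi. *)
pose psi x : C^o := (phi (star H x))^*.
have psi_lin : linear psi.
  move=> k x y; rewrite /psi (star_antilinear (starP H)) linearP /=.
  by rewrite rmorphD rmorphM /= conjCK.
pose psi' : {linear A -> C^o} :=
  HB.pack psi (GRing.isLinear.Build _ _ _ _ psi psi_lin).
exists (linfun psi').
have bB := slicer_balanced A (linfun psi').
rewrite -{2}(star1 H) comul_star (tsum_tsum _ _ bB) raddf_tsum; last exact: starD.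
apply: eq_tsum => x y; rewrite (tsum_pure bB) lfunE /= /psi starZ.
by rewrite (star_involutive (starP H)).
Qed.

(** Apply [comul_A_right] to the star of b, again in A_R, and take stars, which reverses the
    product. *)
Lemma comul_A_right' b : A_right H b ->
  Delta b = \tsum_(x, y <- Delta 1) x \ox (b * y).
Proof.
move=> bR; have sM := star_antimul (starP H).
have sK := star_involutive (starP H).
rewrite -{1}(sK b) comul_star (comul_A_right (A_right_star bR)).
rewrite (tsum_tsum _ _ (star_bal H)).
have bB : balanced (fun x y : A => x \ox (b * y)) by bal.
rewrite -[in RHS](star1 H) comul_star (tsum_tsum _ _ bB).
by apply: eq_tsum => x y; rewrite (tsum_pure (star_bal H)) (tsum_pure bB) sM sK.
Qed.

Lemma comul_A_right_mull b a : A_right H b ->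
  Delta (b * a) = \tsum_(x, y <- Delta a) x \ox (b * y).
Proof.
move=> bR; rewrite comulM (comul_A_right' bR).
have -> : \tsum_(x, y <- Delta 1) x \ox (b * y) =
    tmul *%R *%R (1 \ox b) (Delta 1).
  by rewrite tmul_purel //; apply: eq_tsum => x y; rewrite mul1r.
rewrite -mulAP -comulM mul1r tmul_purel //.
by apply: eq_tsum => x y; rewrite mul1r.
Qed.

Lemma comul_A_right_mulr b a : A_right H b ->
  Delta (a * b) = \tsum_(x, y <- Delta a) x \ox (y * b).
Proof.
move=> bR; rewrite comulM (comul_A_right bR).
have -> : \tsum_(x, y <- Delta 1) x \ox (y * b) =
    tmul *%R *%R (Delta 1) (1 \ox b).
  by rewrite tmul_purer //; apply: eq_tsum => x y; rewrite mulr1.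
rewrite mulAP -comulM mulr1 tmul_purer //.
by apply: eq_tsum => x y; rewrite mulr1.
Qed.

Lemma comul_inj x y : Delta x = Delta y -> x = y.
Proof. by move=> e; rewrite -(counitl H x) e counitl. Qed.

(** Both products have the coproduct l 1_1 (x) r 1_2, and the coproduct is injective. *)
Lemma A_left_A_right_comm l r : A_left H l -> A_right H r -> l * r = r * l.
Proof.
move=> lL rR; apply: comul_inj.
rewrite (comul_A_left_mull _ lL) (comul_A_right_mull _ rR).
rewrite (comul_A_right' rR) (comul_A_left lL).
rewrite !tsum_tsum; [|bal..].
by apply: eq_tsum => x y; rewrite !tsum_pure //; bal.
Qed.

Lemma tsum_comulM (W : zmodType) (B : A -> A -> W) x y : balanced B ->
  tsum B (Delta (x * y)) =
  \tsum_(x1, x2 <- Delta x) \tsum_(y1, y2 <- Delta y) B (x1 * y1) (x2 * y2).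
Proof.
move=> bB; rewrite comulM /tmul tsum_tsum //; apply: eq_tsum => p q.
by rewrite tsum_tsum //; apply: eq_tsum => ? ?; rewrite tsum_pure.
Qed.

(** The conjugate of eps (star x), as a functional of x, is a left counit, while eps is a right
    counit; hence they agree. *)
Lemma counit_star x : eps (star H x) = (eps x)^*.
Proof.
have fD : {morph (fun x => (eps (star H x))^*) : x y / x + y}.
  by move=> p q; rewrite starD dualD rmorphD.
apply: (can_inj conjCK); rewrite conjCK.
transitivity (\tsum_(x1, x2 <- Delta x) eps x2 * (eps (star H x1))^*).
  rewrite -{1}(counitr H x) (raddf_tsum _ _ fD); apply: eq_tsum => p q.
  by rewrite starZ dualZ rmorphM /= conjCK.
have {2}<- : \tsum_(x1, x2 <- Delta x) (eps (star H x1))^* *: x2 = x.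
  have sK := star_involutive (starP H).
  apply: (can_inj sK); rewrite (raddf_tsum (f := star H)); last exact: starD.
  rewrite -[RHS](counitl H) comul_star.
  rewrite (tsum_tsum _ _ (slicel_balanced _ _)); apply: eq_tsum => p q.
  by rewrite starZ conjCK (tsum_pure (slicel_balanced _ _)).
rewrite (raddf_tsum (f := fun x => eps x : C)); last exact: dualD.
by apply: eq_tsum => p q; rewrite dualZ mulrC.
Qed.

(** The axiom [counitM] conjugated by the star: the reversal of products interchanges the roles of
    the legs of y. *)
Lemma counitM' x y z :
  eps (x * y * z) = \tsum_(y1, y2 <- Delta y) eps (x * y2) * eps (y1 * z).
Proof.
have sM := star_antimul (starP H); have sK := star_involutive (starP H).
rewrite -[LHS]conjCK -counit_star !sM mulrA counitM comul_star.
have bB : balanced (fun p q : A => (eps (star H z * p) : C) * eps (q * star H x) : C).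
  split=> [p p' q|p q q'|k p q]; first by rewrite mulrDr dualD mulrDl.
    by rewrite mulrDl dualD mulrDr.
  by rewrite -[in RHS]scalerAl -scalerAr !dualZ mulrCA mulrA.
rewrite (tsum_tsum _ _ bB) (raddf_tsum (f := fun c : C => c^*)); last first.
  by move=> p q; rewrite rmorphD.
apply: eq_tsum => p q; rewrite (tsum_pure bB) -!sM !counit_star rmorphM /= !conjCK.
exact: mulrC.
Qed.

(** The two counital maps, with values in A_L and A_R. The axioms [antipoder] and [antipodel]
    express them through eps and Delta(1). *)
Definition eps_left x := \tsum_(x1, x2 <- Delta x) x1 * S x2.
Definition eps_right x := \tsum_(x1, x2 <- Delta x) S x1 * x2.

Lemma eps_left_linear : linear eps_left.
Proof.
move=> k x y; rewrite /eps_left linearP tsumD; last by bal.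
by rewrite tsumZ // => *; rewrite scalerAl.
Qed.

Lemma eps_right_linear : linear eps_right.
Proof.
move=> k x y; rewrite /eps_right linearP tsumD; last by bal.
by rewrite tsumZ // => *; rewrite linearZ scalerAl.
Qed.

HB.instance Definition _ := GRing.isLinear.Build C A A _ eps_left eps_left_linear.
HB.instance Definition _ := GRing.isLinear.Build C A A _ eps_right eps_right_linear.

Lemma A_left_eps x : A_left H (eps_left x).
Proof. exact: eps_left_in. Qed.

Lemma A_right_eps x : A_right H (eps_right x).
Proof.
exists (linfun (fun u : A => eps (x * u))).
have l : linear (fun u : A => eps (x * u)).
  by move=> k u v; rewrite mulrDr -scalerAr linearP.
pose f : {linear A -> C^o} := HB.pack (fun u : A => eps (x * u))
  (GRing.isLinear.Build _ _ _ _ (fun u : A => eps (x * u)) l).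
by rewrite /eps_right antipodel; apply: eq_tsum => u v; rewrite (lfunE f).
Qed.

Lemma eps_right1 : eps_right 1 = 1.
Proof.
rewrite /eps_right antipodel -[RHS](counitr H).
by apply: eq_tsum => x y; rewrite mul1r.
Qed.

(** By [antipoder] the left side is eps(x 1_2) eps(1_1 y), which is [counitM'] with middle factor
    1. *)
Lemma counit_eps_left x y : eps (x * eps_left y) = eps (x * y) :> C.
Proof.
rewrite /eps_left antipoder -[in RHS](mulr1 x) counitM'.
rewrite (raddf_tsum (f := fun z => eps (x * z) : C)) => [|? ?]; last first.
  by rewrite mulrDr dualD.
by apply: eq_tsum => u v; rewrite -scalerAr dualZ mulrC.
Qed.

Lemma counit_eps_right x y : eps (eps_right x * y) = eps (x * y) :> C.
Proof.
rewrite /eps_right antipodel -[in RHS](mulr1 x) counitM'.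
rewrite (raddf_tsum (f := fun z => eps (z * y) : C)) => [|? ?]; last first.
  by rewrite mulrDl dualD.
by apply: eq_tsum => u v; rewrite -scalerAl dualZ.
Qed.

(** By [antipoder], eps_left z depends on z only through the numbers eps(u z), to which
    [counit_eps_left] applies. *)
Lemma eps_left_mul_eps x y : eps_left (x * eps_left y) = eps_left (x * y).
Proof.
rewrite {1 3}/eps_left !antipoder; apply: eq_tsum => u v.
by rewrite mulrA counit_eps_left mulrA.
Qed.

Lemma eps_right_mul_eps x y : eps_right (eps_right x * y) = eps_right (x * y).
Proof.
rewrite {1 3}/eps_right !antipodel; apply: eq_tsum => u v.
by rewrite -mulrA counit_eps_right mulrA.
Qed.

(** Since Delta(l) = 1_1 l (x) 1_2, the formula of [antipoder] becomes the left counit axiom. *)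
Lemma eps_left_id l : A_left H l -> eps_left l = l.
Proof.
move=> lL; rewrite /eps_left antipoder -[RHS](counitl H) (comul_A_left' lL).
rewrite (tsum_tsum _ _ (slicel_balanced _ _)); apply: eq_tsum => x y.
by rewrite (tsum_pure (slicel_balanced _ _)).
Qed.

Lemma antipode_eps_left x : \tsum_(x1, x2 <- Delta x) S x1 * eps_left x2 = S x.
Proof.
rewrite -[RHS]antipodeP; apply: eq_tsum => p q.
rewrite /eps_left (raddf_tsum (f := *%R (S p))) => [|? ?]; last exact: mulrDr.
by apply: eq_tsum => u v; rewrite mulrA.
Qed.

Lemma eps_right_antipode x : \tsum_(x1, x2 <- Delta x) eps_right x1 * S x2 = S x.
Proof.
rewrite -[RHS]antipodeP -comul_coassoc; last by bal.
apply: eq_tsum => p q.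
by rewrite /eps_right (raddf_tsum (f := *%R^~ (S q))) => [|? ?]; last exact: mulrDl.
Qed.

End WeakHopfAlgebra.

(** Transfers a tensor identity in Sweedler notation to every balanced expression in the same
    legs. *)
Lemma tsum_pure_congr (K : fieldType) (U : lmodType K) (V : vectType K)
    (U1 : lmodType K) (V1 : vectType K) (U2 : lmodType K) (V2 : vectType K)
    (W : zmodType) (B : U -> V -> W)
    (f : U1 -> V1 -> U) (g : U1 -> V1 -> V) (f' : U2 -> V2 -> U)
    (g' : U2 -> V2 -> V) s t : balanced B ->
  \tsum_(x, y <- s) f x y \ox g x y = \tsum_(x, y <- t) f' x y \ox g' x y ->
  \tsum_(x, y <- s) B (f x y) (g x y) = \tsum_(x, y <- t) B (f' x y) (g' x y).
Proof.
move=> bB /(congr1 (tsum B)); rewrite !(tsum_tsum _ _ bB).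
by under eq_tsum do rewrite (tsum_pure bB); under [RHS]eq_tsum do rewrite (tsum_pure bB).
Qed.

(** * The antipode *)

Section Antipode.
Variables (C : numClosedFieldType) (A : falgType C) (H : weak_Cstar_Hopf A).
Local Notation Delta := (comul H).
Local Notation S := (antipode H).
Local Notation eps := (counit H).
Local Notation epsL := (eps_left H).
Local Notation epsR := (eps_right H).
Implicit Types (a b l r x y z : A).

Lemma eps_left_conv x l : A_left H l ->
  \tsum_(x1, x2 <- Delta x) x1 * l * S x2 = epsL (x * l).
Proof.
move=> lL; rewrite /eps_left (comul_A_left_mulr _ lL) tsum_tsum; last by bal.
by apply: eq_tsum => p q; rewrite tsum_pure //; bal.
Qed.

Lemma eps_right_conv y r : A_right H r ->
  \tsum_(y1, y2 <- Delta y) S y1 * r * y2 = epsR (r * y).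
Proof.
move=> rR; rewrite /eps_right (comul_A_right_mull _ rR) tsum_tsum; last by bal.
by apply: eq_tsum => p q; rewrite tsum_pure ?mulrA //; bal.
Qed.

(** Coassociativity in x and y at once, as needed for the coproduct of a product x y. *)
Lemma comul_coassoc2 (W : zmodType) (F : A -> A -> A -> A -> A -> A -> W) x y :
  (forall y1 y2 y3, trilinear_map (fun x1 x2 x3 => F x1 y1 x2 y2 x3 y3)) ->
  (forall x1 x2 x3, trilinear_map (fun y1 y2 y3 => F x1 y1 x2 y2 x3 y3)) ->
  \tsum_(x1, x2 <- Delta x) \tsum_(y1, y2 <- Delta y)
    \tsum_(p, q <- Delta x1) \tsum_(p', q' <- Delta y1) F p p' q q' x2 y2 =
  \tsum_(x1, x2 <- Delta x) \tsum_(y1, y2 <- Delta y)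
    \tsum_(p, q <- Delta x2) \tsum_(p', q' <- Delta y2) F x1 y1 p p' q q'.
Proof.
move=> Fx Fy; pose G x1 x2 x3 := \tsum_(y1, y2 <- Delta y)
  \tsum_(p', q' <- Delta y2) F x1 y1 x2 p' x3 q'.
have GT : trilinear_map G.
  split=> *; rewrite /G.
  - by do 2!apply: tsumDf => ? ?; rewrite (triD1 (Fx _ _ _)).
  - by do 2!apply: tsumDf => ? ?; rewrite (triD2 (Fx _ _ _)).
  - by do 2!apply: tsumDf => ? ?; rewrite (triD3 (Fx _ _ _)).
  - by do 2!apply: eq_tsum => ? ?; rewrite (triZ12 (Fx _ _ _)).
  - by do 2!apply: eq_tsum => ? ?; rewrite (triZ13 (Fx _ _ _)).
transitivity (\tsum_(x1, x2 <- Delta x) \tsum_(p, q <- Delta x1) G p q x2).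
  apply: eq_tsum => x1 x2; rewrite exchange_tsum; apply: eq_tsum => p q.
  exact: (comul_coassoc _ _ (Fy _ _ _)).
rewrite (comul_coassoc _ _ GT); apply: eq_tsum => x1 x2.
by rewrite [RHS]exchange_tsum.
Qed.

(* Both sides equal eps_right(x_1 y_1) S(y_2) S(x_2). *)
Lemma antipodeM x y : S (x * y) = S y * S x.
Proof.
transitivity (\tsum_(x1, x2 <- Delta x) \tsum_(y1, y2 <- Delta y)
    epsR (x1 * y1) * S y2 * S x2).
  rewrite -antipode_eps_left tsum_comulM; last by bal.
  transitivity (\tsum_(x1, x2 <- Delta x) \tsum_(y1, y2 <- Delta y)
    \tsum_(p, q <- Delta x2) \tsum_(p', q' <- Delta y2)
      S (x1 * y1) * p * p' * S q' * S q).
    apply: eq_tsum => x1 x2; apply: eq_tsum => y1 y2.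
    (* Here eps_left(x_2 y_2) = x_2 eps_left(y_2) S(x_3), so the antipodes of the separate factors
       appear. *)
    rewrite -eps_left_mul_eps -(eps_left_conv _ (A_left_eps _ _)).
    rewrite (raddf_tsum (f := *%R _)) => [|? ?]; last exact: mulrDr.
    apply: eq_tsum => p q.
    rewrite /eps_left (raddf_tsum (f := fun z => S (x1 * y1) * (p * z * S q))).
      by apply: eq_tsum => p' q'; rewrite !mulrA.
    by move=> ? ?; rewrite mulrDr mulrDl mulrDr.
  rewrite -(comul_coassoc2 (F := fun x1 y1 x2 y2 x3 y3 =>
     S (x1 * y1) * x2 * y2 * S y3 * S x3)); [|by move=> *; bal..].
  apply: eq_tsum => x1 x2; apply: eq_tsum => y1 y2.
  rewrite /eps_right tsum_comulM; last by bal.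
  rewrite (raddf_tsum (f := fun z => z * S y2 * S x2)) => [|? ?]; last first.
    by rewrite !mulrDl.
  apply: eq_tsum => p q.
  rewrite (raddf_tsum (f := fun z => z * S y2 * S x2)) => [|? ?]; last first.
    by rewrite !mulrDl.
  by apply: eq_tsum => p' q'; rewrite !mulrA.
rewrite -(eps_right_antipode H x) (raddf_tsum (f := *%R (S y))) => [|? ?]; last first.
  exact: mulrDr.
apply: eq_tsum => x1 x2.
rewrite -(antipode_eps_left H y) (raddf_tsum (f := *%R^~ _)) => [|? ?]; last first.
  exact: mulrDl.
transitivity (\tsum_(y1, y2 <- Delta y) \tsum_(p, q <- Delta y2)
    S y1 * epsR x1 * p * S q * S x2); last first.
  apply: eq_tsum => y1 y2.
  (* Commuting eps_right(x_1) past eps_left(y_2) puts it between S(y_1) and y_2, where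
     [eps_right_conv] absorbs it. *)
  rewrite -!mulrA [epsL y2 * _]mulrA (A_left_A_right_comm (A_left_eps _ _) (A_right_eps _ _)).
  rewrite /(epsL _) (raddf_tsum (f := fun z => S y1 * (epsR x1 * z * S x2))).
    by apply: eq_tsum => p q; rewrite !mulrA.
  by move=> ? ?; rewrite mulrDr mulrDl mulrDr.
rewrite -comul_coassoc; last by bal.
apply: eq_tsum => y1 y2.
rewrite -eps_right_mul_eps -(eps_right_conv _ (A_right_eps _ _)).
rewrite (raddf_tsum (f := fun z => z * S y2 * S x2)) => [|? ?]; last first.
  by rewrite !mulrDl.
by apply: eq_tsum => p q; rewrite ?mulrA.
Qed.

(* u b = b_1 eps (u b_2) for u in A_right, the first leg of the coproduct of 1. *)
Lemma comul_eps_left b :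
  \tsum_(b1, b2 <- Delta b) b1 \ox epsL b2 =
  \tsum_(u, v <- Delta 1) (u * b) \ox v.
Proof.
transitivity (\tsum_(u, v <- Delta 1) \tsum_(b1, b2 <- Delta b)
    b1 \ox (eps (u * b2) *: v)); last first.
  apply: eq_tsum_comul1 => r y rR.
  rewrite -[in RHS](counitr H (r * b)) (comul_A_right_mull _ rR).
  rewrite (tsum_tsum _ _ (slicer_balanced _ _)).
  rewrite (raddf_tsum (f := fun z => z \ox y)) => [|? ?]; last exact: pureDl.
  apply: eq_tsum => p q; rewrite (tsum_pure (slicer_balanced _ _)).
  by rewrite pureZl pureZr.
rewrite exchange_tsum; apply: eq_tsum => p q.
rewrite /eps_left antipoder; apply: raddf_tsum => ? ?; exact: pureDr.
Qed.

(** * The Haar integral and the antipode *)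

Section Haar.
Variable h : A.
Hypothesis hH : Haar_integral H h.

(** Since Delta(h) = Delta(h) Delta(1), [comul_eps_left] gives h_1 b (x) h_2 = h_1 b_1 (x) h_2 b_2
    S(b_3). This is Delta(h b_1) (1 (x) S(b_2)), where b_1 may be replaced by eps_right(b_1), which
    multiplies only the second leg; finally eps_right(b_1) S(b_2) = S(b). The script builds this
    chain from its last term backwards. *)
Lemma Haar_antipode b :
  \tsum_(x, y <- Delta h) (x * b) \ox y = \tsum_(x, y <- Delta h) x \ox (y * S b).
Proof.
have pD := @balDr _ _ _ _ _ (@pure_balanced C A A).
transitivity (\tsum_(b1, b2 <- Delta b) \tsum_(x, y <- Delta h)
   x \ox (y * (epsR b1 * S b2))); last first.
  rewrite exchange_tsum; apply: eq_tsum => x y.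
  rewrite -[in RHS](eps_right_antipode H b).
  by rewrite (raddf_tsum (f := fun z => x \ox (y * z))) // => ? ?; rewrite mulrDr pureDr.
transitivity (\tsum_(b1, b2 <- Delta b) \tsum_(x, y <- Delta (h * b1))
   x \ox (y * S b2)); last first.
  apply: eq_tsum => b1 b2; rewrite (Haar_right hH) -/(eps_right H b1).
  rewrite (comul_A_right_mulr _ (A_right_eps _ _)).
  rewrite tsum_tsum; last by bal.
  by apply: eq_tsum => x y; rewrite tsum_pure ?mulrA //; bal.
transitivity (\tsum_(x, y <- Delta h) \tsum_(b1, b2 <- Delta b)
    \tsum_(p, q <- Delta b1) (x * p) \ox (y * q * S b2)); last first.
  rewrite exchange_tsum; apply: eq_tsum => b1 b2.
  by rewrite tsum_comulM //; bal.
transitivity (\tsum_(x, y <- Delta h) \tsum_(b1, b2 <- Delta b)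
     (x * b1) \ox (y * epsL b2)); last first.
  apply: eq_tsum => x y; rewrite comul_coassoc; last by bal.
  apply: eq_tsum => b1 b2; rewrite /eps_left.
  rewrite (raddf_tsum (f := fun z => (x * b1) \ox (y * z))) => [|? ?]; last first.
    by rewrite mulrDr pureDr.
  by apply: eq_tsum => p q; rewrite mulrA.
transitivity (\tsum_(x, y <- Delta h) \tsum_(u, v <- Delta 1)
     (x * (u * b)) \ox (y * v)); last first.
  apply: eq_tsum => x y; apply: esym.
  by apply: (tsum_pure_congr (B := fun p q => (x * p) \ox (y * q))
    _ (comul_eps_left b)); bal.
rewrite -{1}(mulr1 h) tsum_comulM; last by bal.
by apply: eq_tsum => x y; apply: eq_tsum => p q; rewrite mulrA.
Qed.

Section Dual.
Variable lambda : dual A.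
Hypotheses (lambda_int : left_integral H lambda)
  (lambda_dual : harpoon H lambda h = 1).

(* If S c = 0 then h_1 c (x) h_2 = 0; slice with lambda. *)
Lemma antipode_lker0 : lker S == 0%VS.
Proof.
apply/lker0P => b b'; suff S0 c : S c = 0 -> c = 0.
  by move=> e; apply/subr0_eq/S0; rewrite linearB /= e subrr.
move=> Sc; rewrite -(mul1r c) -lambda_dual /harpoon.
rewrite (raddf_tsum (f := *%R^~ c)) => [|? ?]; last exact: mulrDl.
have bB := slicer_balanced A lambda.
transitivity (\tsum_(x, y <- Delta h) lambda y *: (x * c)).
  by apply: eq_tsum => x y; rewrite scalerAl.
rewrite (tsum_pure_congr bB (Haar_antipode c)) /tsum big1 // => i _.
by rewrite Sc mulr0 linear0 scale0r.
Qed.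

Lemma antipode_surj a : exists b, a = S b.
Proof. by exists ((S^-1)%VF a); rewrite lker0_lfunVK // antipode_lker0. Qed.

End Dual.
End Haar.
End Antipode.

(** * Integrals *)

Section Integrals.
Variables (C : numClosedFieldType) (A : falgType C) (H : weak_Cstar_Hopf A).
Local Notation Delta := (comul H).
Local Notation S := (antipode H).
Local Notation eps := (counit H).
Local Notation epsL := (eps_left H).
Local Notation epsR := (eps_right H).
Implicit Types (a b l r x y z : A) (phi psi : dual A).

Lemma harpoon_linear phi : linear (harpoon H phi).
Proof.
move=> k x y; rewrite /harpoon linearP tsumD; last exact: slicer_balanced.
by rewrite tsumZ // => c p q; rewrite !scalerA mulrC.
Qed.

HB.instance Definition _ phi :=
  GRing.isLinear.Build C A A _ (harpoon H phi) (harpoon_linear phi).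

(** Elements of A_L multiply only the first leg of a coproduct, and the harpoon slices the
    second. *)
Lemma harpoonMl phi l a : A_left H l -> harpoon H phi (l * a) = l * harpoon H phi a.
Proof.
move=> lL; rewrite /harpoon (comul_A_left_mull _ lL).
rewrite (tsum_tsum _ _ (slicer_balanced _ _)).
rewrite [RHS](raddf_tsum (f := *%R l)) => [|? ?]; last exact: mulrDr.
by apply: eq_tsum => p q; rewrite (tsum_pure (slicer_balanced _ _)) scalerAr.
Qed.

Lemma harpoonMr phi l a : A_left H l -> harpoon H phi (a * l) = harpoon H phi a * l.
Proof.
move=> lL; rewrite /harpoon (comul_A_left_mulr _ lL).
rewrite (tsum_tsum _ _ (slicer_balanced _ _)).
rewrite [RHS](raddf_tsum (f := *%R^~ l)) => [|? ?]; last exact: mulrDl.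
by apply: eq_tsum => p q; rewrite (tsum_pure (slicer_balanced _ _)) scalerAl.
Qed.

Lemma comul_harpoon phi a :
  Delta (harpoon H phi a) = \tsum_(a1, a2 <- Delta a) a1 \ox harpoon H phi a2.
Proof.
transitivity (\tsum_(a1, a2 <- Delta a) \tsum_(p, q <- Delta a1) phi a2 *: (p \ox q)).
  rewrite /harpoon raddf_tsum => [|? ?]; last exact: linearD.
  apply: eq_tsum => x y; rewrite linearZ /= {1}(tens_sum (Delta x)).
  by apply: (raddf_tsum (f := *:%R (phi y))) => ? ?; apply: scalerDr.
have bF : trilinear_map (fun p q r : A => phi r *: (p \ox q)) by bal.
rewrite (comul_coassoc _ _ bF).
apply: eq_tsum => x y; rewrite /harpoon.
rewrite (raddf_tsum (f := fun z => x \ox z)) => [|? ?]; last exact: pureDr.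
by apply: eq_tsum => p q; rewrite pureZr.
Qed.

Lemma counit_harpoon phi a : eps (harpoon H phi a) = phi a :> C.
Proof.
rewrite -[in RHS](counitl H a) /harpoon.
rewrite (raddf_tsum (f := fun x => eps x : C)); last exact: dualD.
rewrite (raddf_tsum (f := fun x => phi x : C)); last exact: dualD.
by apply: eq_tsum => p q; rewrite !dualZ mulrC.
Qed.

Lemma dual_separates x y : (forall phi, phi x = phi y :> C) -> x = y.
Proof.
move=> e; rewrite (coord_vbasis (memvf x)) (coord_vbasis (memvf y)).
by apply: eq_bigr => i _; rewrite -!dual_basisE [X in X *: _]e.
Qed.

(** Evaluated at a, the defining equation compares psi at phi -> a and at eps_left(phi -> a). It
    therefore says that phi -> a is fixed by [eps_left], that is, lies in A_L. *)
Lemma left_integralP phi :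
  left_integral H phi <-> forall a, A_left H (harpoon H phi a).
Proof.
have L psi a : dual_mul H psi phi a = psi (harpoon H phi a) :> C.
  rewrite dual_mulE /harpoon (raddf_tsum (f := fun x => psi x : C)); last exact: dualD.
  by apply: eq_tsum => p q; rewrite dualZ mulrC.
have R psi a : (\tsum_(psi1, psi2 <- dual_comul psi)
      dual_mul H (dual_mul H psi1 (dual_antipode H psi2)) phi) a =
    psi (epsL (harpoon H phi a)) :> C.
  rewrite (raddf_tsum (f := fun g : dual A => g a : C)) => [|? ?]; last by rewrite lfunE.
  transitivity (\tsum_(p, q <- Delta (harpoon H phi a))
    tsum (fun psi1 psi2 : dual A => psi1 p * psi2 (S q)) (dual_comul psi)).
    rewrite exchange_tsum; apply: eq_tsum => psi1 psi2; rewrite L dual_mulE.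
    by apply: eq_tsum => p q; rewrite lfunE.
  rewrite /eps_left (raddf_tsum (f := fun x => psi x : C)); last exact: dualD.
  by apply: eq_tsum => p q; apply: dual_comulE.
split=> [hphi a|hphi psi].
  suff -> : harpoon H phi a = epsL (harpoon H phi a) by apply: A_left_eps.
  by apply: dual_separates => psi; rewrite -L hphi R.
by apply/lfunP => a; rewrite [LHS]L [RHS]R eps_left_id.
Qed.

Lemma antipode_harpoon phi a :
  \tsum_(a1, a2 <- Delta a) S a1 * harpoon H phi a2 = epsR (harpoon H phi a).
Proof.
rewrite /eps_right comul_harpoon tsum_tsum; last by bal.
by apply: eq_tsum => p q; rewrite tsum_pure //; bal.
Qed.

(** From eps(z l) = eps(z 1_1) eps(1_2 l) with 1_2 in A_L, the hypothesis extends to all z in A;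
    then l = eps_left(l) = eps(1_1 l) 1_2 vanishes. *)
Lemma A_left_counit0 l : A_left H l ->
  (forall l', A_left H l' -> eps (l' * l) = 0 :> C) -> l = 0.
Proof.
move=> lL l0; have l0' z : eps (z * l) = 0 :> C.
  rewrite -[z]mulr1 counitM; have [y yL ->] := comul1_A_left H.
  have bB : balanced (fun p q : A => (eps (z * p) : C) * eps (q * l)).
    split=> [p p' q|p q q'|k p q]; first by rewrite mulrDr dualD mulrDl.
      by rewrite mulrDl dualD mulrDr.
    by rewrite -[in RHS]scalerAl -scalerAr !dualZ mulrCA mulrA.
  rewrite tsum_bigsum // big1 // => i _.
  by rewrite tsum_pure // l0 ?mulr0.
rewrite -(eps_left_id lL) /eps_left antipoder /tsum big1 // => i _.
by rewrite [X in X *: _]l0' scale0r.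
Qed.

(** * The quasi-basis formed from the Haar integral *)

Section Dual.
Variables (h : A) (lambda : dual A).
Hypotheses (hH : Haar_integral H h) (lambda_int : left_integral H lambda)
  (lambda_dual : harpoon H lambda h = 1).

(** With a = S(b), this is [Haar_antipode] after applying the antimultiplicative S to the first
    leg. *)
Lemma Haar_antipode_swap a :
  \tsum_(x, y <- Delta h) S x \ox (y * a) = \tsum_(x, y <- Delta h) (a * S x) \ox y.
Proof.
have [b ->] := antipode_surj hH lambda_dual a.
have bB : balanced (fun x y => S x \ox y) by bal.
rewrite -(tsum_pure_congr bB (Haar_antipode hH b)).
by apply: eq_tsum => x y; rewrite antipodeM.
Qed.

Lemma A_left_harpoon a : A_left H (harpoon H lambda a).
Proof. by move/left_integralP: lambda_int. Qed.

(** Moving a to the left leaves a S(h_1) (lambda -> h_2) = a eps_right(lambda -> h), and lambda -> h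
    = 1. *)
Lemma quasi_basisl a : \tsum_(x, y <- Delta h) S x * harpoon H lambda (y * a) = a.
Proof.
have bB : balanced (fun x y => x * harpoon H lambda y) by bal.
rewrite (tsum_pure_congr bB (Haar_antipode_swap a)).
rewrite -[RHS]mulr1 -(eps_right1 H) -lambda_dual -antipode_harpoon.
rewrite [RHS](raddf_tsum (f := *%R a)) => [|? ?]; last exact: mulrDr.
by apply: eq_tsum => x y; rewrite mulrA.
Qed.

(** Each lambda -> y z lies in A_L and has eps(l (lambda -> y z)) = lambda(l y z) = 0, so it
    vanishes; [quasi_basisl] then gives z = 0. *)
Lemma integral_nondegl z : (forall y, lambda (y * z) = 0 :> C) -> z = 0.
Proof.
move=> z0; rewrite -(quasi_basisl z) /tsum big1 // => i _.
rewrite (_ : harpoon H lambda _ = 0) ?mulr0 //.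
apply: A_left_counit0 => [|l lL]; first exact: A_left_harpoon.
by rewrite -harpoonMl // counit_harpoon mulrA.
Qed.

(** In finite dimension nondegeneracy on one side implies it on the other: the Gram map f is
    injective, hence bijective. *)
Lemma integral_nondegr w : (forall y, lambda (w * y) = 0 :> C) -> w = 0.
Proof.
move=> w0; pose e := vbasis {:A}.
pose f z := \sum_(i < \dim {:A}) lambda (e`_i * z) *: e`_i.
have fl : linear f.
  move=> k u v; rewrite /f scaler_sumr -big_split; apply: eq_bigr => i _.
  by rewrite mulrDr -scalerAr dualD dualZ scalerDl scalerA.
pose fL : 'End(A) := linfun (HB.pack f (GRing.isLinear.Build _ _ _ _ f fl) : {linear A -> A}).
have fE z : fL z = f z by rewrite lfunE.
have f_inj : lker fL == 0%VS.
  apply/lker0P => x y; suff f0 z : fL z = 0 -> z = 0.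
    by move=> exy; apply/subr0_eq/f0; rewrite linearB /= exy subrr.
  rewrite fE => fz; apply: integral_nondegl => u.
  rewrite (coord_vbasis (memvf u)) mulr_suml.
  rewrite linear_sum big1 // => i _ /=; rewrite -scalerAl dualZ.
  have /freeP/(_ (fun i => lambda (e`_i * z))) := basis_free (vbasisP {:A}).
  by move=> /(_ fz i) ->; rewrite mulr0.
rewrite (coord_vbasis (memvf w)) big1 // => j _.
(* The lambda-dual vector to the basis vector of index j: lambda(w z) is the j-th coordinate of
   w. *)
pose z := (fL^-1)%VF e`_j.
have fz : f z = e`_j by rewrite -fE /z lker0_lfunVK.
have lz (i : 'I_(\dim {:A})) : lambda (e`_i * z) = (i == j)%:R :> C.
  rewrite -(coord_sum_free (fun i : 'I_(\dim {:A}) => lambda (e`_i * z)) i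
    (basis_free (vbasisP {:A}))).
  by rewrite -/(f z) fz coord_free ?(basis_free (vbasisP _)) // eq_sym.
have := w0 z; rewrite {1}(coord_vbasis (memvf w)) mulr_suml linear_sum.
rewrite (bigD1 j) //= big1 ?addr0 => [|i ij]; last first.
  by rewrite -scalerAl dualZ lz (negbTE ij) mulr0.
by rewrite -scalerAl dualZ lz eqxx mulr1 => ->; rewrite scale0r.
Qed.

(* By [integral_nondegr] it is enough to compare both sides under
   c |-> lambda (c b), after expanding b by [quasi_basisl]. *)
Lemma quasi_basisr a : \tsum_(x, y <- Delta h) harpoon H lambda (a * S x) * y = a.
Proof.
apply/subr0_eq/integral_nondegr => b; rewrite mulrBl linearB /=.
apply/eqP; rewrite subr_eq0; apply/eqP.
rewrite -[in RHS](quasi_basisl b) [in RHS](raddf_tsum (f := fun c => lambda (a * c))).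
  rewrite [LHS](raddf_tsum (f := fun c => lambda (c * b))).
    apply: eq_tsum => x y; have hL := A_left_harpoon.
    (* Both sides are eps of (lambda -> a S(x)) (lambda -> y b), by A_L-linearity of the harpoon on
       either side. *)
    rewrite -[LHS]counit_harpoon -(mulrA _ y) (harpoonMl _ _ (hL _)) -(harpoonMr _ _ (hL _)).
    by rewrite counit_harpoon -mulrA.
  by move=> p q; rewrite mulrDl linearD.
by move=> p q; rewrite mulrDr linearD.
Qed.

(** Every left integral arises from lambda by right multiplication by an element of A_R. The factor
    phi -> h_2 lies in A_L and can be pulled out; lambda -> a S(h_1) can then be pulled into phi ->
    h_2, where [quasi_basisr] applies. *)
Lemma harpoon_integral phi a : left_integral H phi ->
  harpoon H lambda (a * epsR (harpoon H phi h)) = harpoon H phi a.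
Proof.
move=> /left_integralP phiL.
rewrite -antipode_harpoon (raddf_tsum (f := fun z => harpoon H lambda (a * z))).
  rewrite -[in RHS](quasi_basisr a) [RHS](raddf_tsum (f := harpoon H phi)).
    apply: eq_tsum => x y.
    by rewrite mulrA (harpoonMr _ _ (phiL _)) (harpoonMl _ _ (A_left_harpoon _)).
  by move=> p q; rewrite linearD.
by move=> p q; rewrite mulrDr linearD.
Qed.

End Dual.

(** The functional lambda(x r) works because r multiplies only the second leg of the coproduct. *)
Lemma left_integral_mulr lambda r : left_integral H lambda -> A_right H r ->
  exists2 phi : dual A, left_integral H phi &
    forall a, harpoon H phi a = harpoon H lambda (a * r).
Proof.
move=> /left_integralP lL rR.
have fl : linear (fun x => lambda (x * r) : C^o).
  by move=> k u v; rewrite mulrDl -scalerAl linearP.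
pose f : {linear A -> C^o} := HB.pack (fun x => lambda (x * r) : C^o)
  (GRing.isLinear.Build _ _ _ _ (fun x => lambda (x * r) : C^o) fl).
have E a : harpoon H (linfun f) a = harpoon H lambda (a * r).
  rewrite /harpoon (comul_A_right_mulr _ rR).
  rewrite (tsum_tsum _ _ (slicer_balanced _ _)); apply: eq_tsum => p q.
  by rewrite (tsum_pure (slicer_balanced _ _)) lfunE.
by exists (linfun f) => //; apply/left_integralP => a; rewrite E.
Qed.

End Integrals.

(** * The crossed product *)

Section TensEval.
Variables (C : numClosedFieldType) (A : falgType C) (M : algType C).

Lemma tens_eval_linear (t : tens M (dual A)) : linear (tens_eval t).
Proof.
move=> k a b; rewrite /tens_eval (raddf_tsum (f := *:%R k)) => [|? ?]; last first.
  exact: scalerDr.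
by apply: tsumDf => m phi; rewrite dualD dualZ scalerDl scalerA.
Qed.

HB.instance Definition _ t :=
  GRing.isLinear.Build C A M _ (tens_eval t) (tens_eval_linear t).

Lemma tens_eval_inj (s t : tens M (dual A)) :
  (forall a, tens_eval s a = tens_eval t a) -> s = t.
Proof.
by move=> e; rewrite -[s]tens_evalK -[t]tens_evalK; apply: eq_bigr => i _; rewrite e.
Qed.

End TensEval.

Section Crossed.
Variables (C : numClosedFieldType) (A : falgType C) (H : weak_Cstar_Hopf A).
Variables (M : algType C) (T : module_algebra H M).
Local Notation Delta := (comul H).
Local Notation S := (antipode H).
Local Notation "a |> m" := (act T a m) (at level 40, left associativity).
Local Notation iM m := (rtimes T m 1).
Local Notation iA a := (rtimes T 1 a).
Implicit Types (a b l r : A) (m n : M) (phi : dual A) (x y : crossed T).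

(** The stored second legs of Delta(1) are basis vectors, so the sum is first rewritten along
    [comul1_A_left]; balancedness permits this. *)
Lemma eq_tsum_comul1_left (W : zmodType) (B B' : A -> A -> W) :
  balanced B -> balanced B' -> (forall a l, A_left H l -> B a l = B' a l) ->
  tsum B (Delta 1) = tsum B' (Delta 1).
Proof.
move=> bB bB' e; have [y yL ->] := comul1_A_left H.
by rewrite !tsum_bigsum //; apply: eq_bigr => i _; rewrite !tsum_pure // e.
Qed.

Lemma rtimes_balanced : balanced (rtimes T).
Proof.
split=> [m n a|m a b|k m a]; rewrite /rtimes ?pureDl ?pureDr ?pi_crossedD //.
by rewrite pureZl pureZr.
Qed.

Lemma rtimesDl m n a : rtimes T (m + n) a = rtimes T m a + rtimes T n a.
Proof. exact: (balDl rtimes_balanced). Qed.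

Lemma rtimesDr m a b : rtimes T m (a + b) = rtimes T m a + rtimes T m b.
Proof. exact: (balDr rtimes_balanced). Qed.

Lemma rtimesZ k m a : rtimes T m (k *: a) = rtimes T (k *: m) a.
Proof. by rewrite (balZ rtimes_balanced). Qed.

Lemma crossed_ext (W : zmodType) (f g : crossed T -> W) :
  {morph f : x y / x + y} -> {morph g : x y / x + y} ->
  (forall m a, f (rtimes T m a) = g (rtimes T m a)) -> f =1 g.
Proof.
move=> fD gD e x; rewrite -[x]reprK; move: (repr x) => s.
apply: (tens_ext (f := fun s => f (\pi_(crossed T)%qT s))
  (g := fun s => g (\pi_(crossed T)%qT s))) => [u v|u v|m a].
- by rewrite pi_crossedD fD.
- by rewrite pi_crossedD gD.
exact: e.
Qed.

(** The leg 1_2 of m (1_1 |> n) (x) 1_2 a lies in A_L, so it crosses the tensor sign and recombines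
    to 1 |> (n 1). *)
Lemma rtimes_mull m n a : iM m * rtimes T n a = rtimes T (m * n) a.
Proof.
rewrite rtimesM -{2}(mulr1 n) -(act1 T (n * 1)) actM.
rewrite (raddf_tsum (f := fun n => rtimes T (m * n) a)) => [|? ?]; last first.
  by rewrite mulrDr rtimesDl.
apply: eq_tsum_comul1_left => [||b l lL].
- split=> [b b' c|b c c'|k b c]; first by rewrite actDl mulrDr rtimesDl.
    by rewrite mulrDl rtimesDr.
  by rewrite actZl -scalerAr -scalerAl rtimesZ.
- split=> [b b' c|b c c'|k b c].
  + by rewrite actDl mulrDl mulrDr rtimesDl.
  + by rewrite actDl !mulrDr rtimesDl.
  by rewrite !actZl -scalerAr -scalerAl.
by rewrite rtimes_A_left // mulrA.
Qed.

Lemma rtimes_split m a : rtimes T m a = iM m * iA a.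
Proof. by rewrite rtimes_mull mulr1. Qed.

(** Replacing a_1 |> 1 by eps_left(a_1) |> 1 lets it cross the tensor sign, and eps_left(a_1) a_2 =
    a. *)
Lemma rtimes1M a b : iA a * iA b = iA (a * b).
Proof.
rewrite rtimesM -[in RHS](eps_left_mul H a).
rewrite (raddf_tsum (f := fun c => iA (c * b))) => [|? ?]; last first.
  by rewrite mulrDl rtimesDr.
apply: eq_tsum => p q; rewrite act_one -/(eps_left H p) -rtimes_A_left ?mulrA //.
exact: A_left_eps.
Qed.

Lemma rtimes1_mulM a m : iA a * iM m = \tsum_(a1, a2 <- Delta a) rtimes T (a1 |> m) a2.
Proof. by rewrite rtimesM; apply: eq_tsum => p q; rewrite mul1r mulr1. Qed.

Lemma rtimes_A_left1 l : A_left H l -> iM (l |> 1) = iA l.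
Proof. by move=> lL; rewrite -[l in RHS]mulr1 rtimes_A_left // mul1r. Qed.

(** As [crossed] is equipped as a ring only, scalars pass between factors through their
    M-components. *)
Lemma rtimesZ_mul k m a n b :
  rtimes T (k *: m) a * rtimes T n b = rtimes T m a * rtimes T (k *: n) b.
Proof.
by rewrite !rtimesM; apply: eq_tsum => p q; rewrite actZr -scalerAl -scalerAr.
Qed.

(** The crossed product implements the action: a_1 m S(a_2) = (a_1 |> m) eps_left(a_2) = (a_1 |> m)
    (a_2 |> 1). *)
Lemma rtimes_act a m :
  iM (a |> m) = \tsum_(a1, a2 <- Delta a) iA a1 * iM m * iA (S a2).
Proof.
transitivity (\tsum_(a1, a2 <- Delta a) \tsum_(p, q <- Delta a2)
    rtimes T (a1 |> m) (p * S q)).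
  rewrite -[m in LHS]mulr1 actM (raddf_tsum (f := fun m => iM m)) => [|? ?]; last first.
    exact: rtimesDl.
  apply: eq_tsum => a1 a2; rewrite -rtimes_mull act_one -/(eps_left H a2).
  rewrite rtimes_A_left1; last exact: A_left_eps.
  rewrite -rtimes_split /eps_left (raddf_tsum (f := rtimes T (a1 |> m))) //.
  by move=> ? ?; apply: rtimesDr.
rewrite -comul_coassoc.
  apply: eq_tsum => a1 a2; rewrite rtimes1_mulM.
  rewrite (raddf_tsum (f := *%R^~ (iA (S a2)))) => [|? ?]; last exact: mulrDl.
  by apply: eq_tsum => p q; rewrite rtimes_split [in RHS]rtimes_split -mulrA rtimes1M.
split=> *.
- by rewrite actDl rtimesDl.
- by rewrite mulrDl rtimesDr.
- by rewrite linearD mulrDr rtimesDr.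
- by rewrite actZl -scalerAl rtimesZ.
- by rewrite actZl linearZ -scalerAr rtimesZ.
Qed.

(** From Delta(r) = 1_1 (x) 1_2 r, moving m past r only lets 1 act on m. *)
Lemma A_right_comm m r : A_right H r -> iM m * iA r = iA r * iM m.
Proof.
move=> rR; rewrite rtimes1_mulM (comul_A_right rR).
rewrite tsum_tsum; last first.
  split=> *; first by rewrite actDl rtimesDl.
    by rewrite rtimesDr.
  by rewrite actZl rtimesZ.
rewrite -rtimes_split -[LHS](mul1r (rtimes T m r)) [LHS]rtimesM.
apply: eq_tsum => p q; rewrite mul1r tsum_pure //.
split=> *; first by rewrite actDl rtimesDl.
  by rewrite rtimesDr.
by rewrite actZl rtimesZ.
Qed.

(** By [rtimes_act] the sum is S(a_1) a_2 m S(a_3) = eps_right(a_1) m S(a_2), and eps_right(a_1)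
    commutes with m. *)
Lemma rtimes_antipode a m :
  \tsum_(a1, a2 <- Delta a) iA (S a1) * iM (a2 |> m) = rtimes T m (S a).
Proof.
transitivity (\tsum_(a1, a2 <- Delta a) \tsum_(p, q <- Delta a2)
    iA (S a1 * p) * rtimes T m (S q)).
  apply: eq_tsum => a1 a2; rewrite rtimes_act.
  rewrite (raddf_tsum (f := *%R (iA (S a1)))) => [|? ?]; last exact: mulrDr.
  by apply: eq_tsum => p q; rewrite (rtimes_split m (S q)) -rtimes1M !mulrA.
rewrite -comul_coassoc; last first.
  split=> *.
  - by rewrite linearD mulrDl rtimesDr mulrDl.
  - by rewrite mulrDr rtimesDr mulrDl.
  - by rewrite linearD rtimesDr mulrDr.
  - by rewrite linearZ -scalerAl -scalerAr.
  - by rewrite !linearZ -scalerAl !rtimesZ rtimesZ_mul.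
rewrite -[in RHS](eps_right_antipode H a).
rewrite (raddf_tsum (f := rtimes T m)) => [|? ?]; last exact: rtimesDr.
apply: eq_tsum => a1 a2; rewrite [RHS]rtimes_split -rtimes1M mulrA.
rewrite (A_right_comm _ (A_right_eps _ _)) -mulrA -rtimes_split /eps_right.
rewrite (raddf_tsum (f := fun c => iA c * rtimes T m (S a2))) => [|? ?] //.
by rewrite rtimesDr mulrDl.
Qed.

Lemma Ehat_mull phi m x : Ehat T phi (iM m * x) = m * Ehat T phi x.
Proof.
apply: (crossed_ext (f := fun x => Ehat T phi (iM m * x))
  (g := fun x => m * Ehat T phi x)) => [u v|u v|n a].
- by rewrite mulrDr EhatD.
- by rewrite EhatD mulrDr.
by rewrite rtimes_mull !Ehat_rtimes mulrA.
Qed.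

(** As phi -> a lies in A_L, ((phi -> a) |> 1) m = (phi -> a) |> m, which [comul_harpoon] expands
    into the left side. *)
Lemma Ehat_mulr phi m x : left_integral H phi ->
  Ehat T phi (x * iM m) = Ehat T phi x * m.
Proof.
move=> phiL; apply: (crossed_ext (f := fun x => Ehat T phi (x * iM m))
  (g := fun x => Ehat T phi x * m)) => [u v|u v|n a].
- by rewrite mulrDl EhatD.
- by rewrite EhatD mulrDl.
rewrite rtimesM Ehat_rtimes (raddf_tsum (f := Ehat T phi)); last exact: EhatD.
rewrite -mulrA -act_A_left; last exact: A_left_harpoon.
rewrite -[m in RHS]mulr1 actM comul_harpoon tsum_tsum; last first.
  split=> *; first by rewrite actDl mulrDl.
    by rewrite actDl mulrDr.
  by rewrite !actZl -scalerAl -scalerAr.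
rewrite (raddf_tsum (f := *%R n)) => [|? ?]; last exact: mulrDr.
apply: eq_tsum => p q; rewrite Ehat_rtimes mulr1 -mulrA tsum_pure //.
split=> *; first by rewrite actDl mulrDl.
  by rewrite actDl mulrDr.
by rewrite !actZl -scalerAl -scalerAr.
Qed.

(** Take m = 1 in the implementer relation; l multiplies only the first leg of Delta(a). *)
Lemma implementer_A_left t l a : implementers T t -> A_left H l ->
  tens_eval t (l * a) = (l |> 1) * tens_eval t a.
Proof.
move=> /implementersE tI lL.
rewrite -[LHS]mulr1 -[tens_eval t a]mulr1 !tI (comul_A_left_mull _ lL).
have bB : balanced (fun a1 a2 => (a1 |> 1) * tens_eval t a2).
  split=> *; first by rewrite actDl mulrDl.
    by rewrite linearD mulrDr.
  by rewrite actZl linearZ -scalerAl -scalerAr.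
rewrite (tsum_tsum _ _ bB) [RHS](raddf_tsum (f := *%R _)) => [|? ?]; last first.
  exact: mulrDr.
by apply: eq_tsum => p q; rewrite (tsum_pure bB) actA (act_A_left _ _ lL) mulrA.
Qed.

Lemma trivial_implementersE t :
  trivial_implementers T t <->
  exists2 phi, left_integral H phi & forall a, tens_eval t a = harpoon H phi a |> 1.
Proof.
have E phi a : tens_eval (impl_mul H (coaction T 1) (1 \ox phi)) a = harpoon H phi a |> 1.
  rewrite eval_impl_mul /harpoon (raddf_tsum (f := fun a => a |> 1)) => [|? ?]; last first.
    exact: actDl.
  apply: eq_tsum => p q.
  by rewrite coactionE tens_eval_pure actZl -scalerAr mulr1.
split=> [[phi phiL <-]|[phi phiL e]]; first by exists phi.
by exists phi => //; apply: tens_eval_inj => a; rewrite E e.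
Qed.

(** * The commutant and the inner implementers *)

Section Implementers.
Variables (h : A) (lambda : dual A).
Hypotheses (hH : Haar_integral H h) (lambda_int : left_integral H lambda)
  (lambda_dual : harpoon H lambda h = 1).
Local Notation E := (Ehat T lambda).
Local Notation t_ := (t_impl T lambda).

(** For x = m a the factor S(h_1) (h_2 |> m) collapses to m S(h_1) by [rtimes_antipode], and
    [quasi_basisl] recovers a. *)
Lemma crossed_quasi_basis x :
  x = \tsum_(h1, h2 <- Delta h) iA (S h1) * iM (E (iA h2 * x)).
Proof.
apply: (crossed_ext (f := id)
  (g := fun x => \tsum_(h1, h2 <- Delta h) iA (S h1) * iM (E (iA h2 * x)))) => //.
  by move=> u v; apply: tsumDf => p q; rewrite mulrDr EhatD rtimesDl mulrDr.
move=> m a; apply: esym.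
transitivity (\tsum_(h1, h2 <- Delta h) \tsum_(p, q <- Delta h2)
    iA (S h1) * iM ((p |> m) * (harpoon H lambda (q * a) |> 1))).
  apply: eq_tsum => h1 h2; rewrite (rtimesM _ 1 h2 m) (raddf_tsum (f := E)); last exact: EhatD.
  rewrite (raddf_tsum (f := fun m => iA (S h1) * iM m)) => [|? ?]; last first.
    by rewrite rtimesDl mulrDr.
  by apply: eq_tsum => p q; rewrite Ehat_rtimes mul1r.
rewrite -comul_coassoc; last first.
  split=> *.
  - by rewrite linearD rtimesDr mulrDl.
  - by rewrite actDl mulrDl rtimesDl mulrDr.
  - by rewrite mulrDl linearD actDl mulrDr rtimesDl mulrDr.
  - by rewrite linearZ actZl rtimesZ rtimesZ_mul scalerAl.
  - by rewrite linearZ -scalerAl linearZ actZl rtimesZ rtimesZ_mul scalerAr.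
rewrite -[in RHS](quasi_basisl hH lambda_dual a).
rewrite (raddf_tsum (f := rtimes T m)) => [|? ?]; last exact: rtimesDr.
apply: eq_tsum => h1 h2; set l := harpoon _ _ _.
have lL : A_left H l by apply: A_left_harpoon.
transitivity (\tsum_(p, q <- Delta h1) iA (S p) * iM (q |> m) * iA l).
  by apply: eq_tsum => p q; rewrite -rtimes_mull rtimes_A_left1 // mulrA.
rewrite -(raddf_tsum (f := *%R^~ (iA l))) => [|? ?]; last exact: mulrDl.
by rewrite rtimes_antipode rtimes_split -mulrA rtimes1M -rtimes_split.
Qed.

Lemma t_implD : {morph t_ : x y / x + y}.
Proof.
move=> x y; apply: tens_eval_inj => a.
by rewrite tens_evalD !t_implE mulrDr EhatD.
Qed.

Lemma t_impl_inj : injective t_.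
Proof.
move=> x y e; rewrite (crossed_quasi_basis x) (crossed_quasi_basis y).
by apply: eq_tsum => p q; rewrite -!t_implE e.
Qed.

(** E(a x) m = E(a x m) = E(a m x) = (a_1 |> m) E(a_2 x). *)
Lemma t_impl_implementers x : commutant T x -> implementers T (t_ x).
Proof.
move=> xC; apply/implementersE => a m.
rewrite t_implE -Ehat_mulr // -mulrA -xC mulrA rtimes1_mulM.
rewrite (raddf_tsum (f := *%R^~ x)) => [|? ?]; last exact: mulrDl.
rewrite (raddf_tsum (f := E)); last exact: EhatD.
by apply: eq_tsum => p q; rewrite t_implE rtimes_split -mulrA Ehat_mull.
Qed.

Lemma t_impl_surj t : implementers T t -> exists2 x, commutant T x & t_ x = t.
Proof.
(* The witness is the expansion of [crossed_quasi_basis] with t(h_2) in place of E(h_2 x). *)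
move=> tI; exists (\tsum_(h1, h2 <- Delta h) iA (S h1) * iM (tens_eval t h2)).
  move=> m; rewrite (raddf_tsum (f := *%R (iM m))) => [|? ?]; last exact: mulrDr.
  transitivity (\tsum_(h1, h2 <- Delta h) \tsum_(p, q <- Delta h1)
      iA (S p) * iM ((q |> m) * tens_eval t h2)).
    apply: eq_tsum => h1 h2; rewrite mulrA -rtimes_split -rtimes_antipode.
    rewrite (raddf_tsum (f := *%R^~ _)) => [|? ?]; last exact: mulrDl.
    by apply: eq_tsum => p q; rewrite -mulrA rtimes_mull.
  rewrite comul_coassoc; last first.
    split=> *.
    - by rewrite linearD rtimesDr mulrDl.
    - by rewrite actDl mulrDl rtimesDl mulrDr.
    - by rewrite linearD mulrDr rtimesDl mulrDr.
    - by rewrite linearZ actZl rtimesZ rtimesZ_mul scalerAl.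
    - by rewrite !linearZ rtimesZ rtimesZ_mul scalerAr.
  rewrite (raddf_tsum (f := *%R^~ (iM m))) => [|? ?]; last exact: mulrDl.
  apply: eq_tsum => h1 h2; rewrite -mulrA rtimes_mull.
  move/implementersE: tI => ->.
  rewrite (raddf_tsum (f := fun m => iA (S h1) * iM m)) // => ? ?.
  by rewrite rtimesDl mulrDr.
apply: tens_eval_inj => a; rewrite t_implE.
rewrite (raddf_tsum (f := fun x => E (iA a * x))) => [|? ?]; last first.
  by rewrite mulrDr EhatD.
(* Since lambda -> a S(h_1) lies in A_L, it can be absorbed into the argument of t, giving t((lambda
   -> a S(h_1)) h_2) = t(a). *)
rewrite -[in RHS](quasi_basisr hH lambda_int lambda_dual a).
rewrite [RHS](raddf_tsum (f := tens_eval t)) => [|? ?]; last exact: linearD.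
apply: eq_tsum => p q; rewrite mulrA rtimes1M Ehat_mulr // Ehat_rtimes mul1r.
by rewrite implementer_A_left //; apply: A_left_harpoon.
Qed.

Lemma t_implZ z x : center z -> commutant T x -> t_ (iM z * x) = implZ z (t_ x).
Proof.
move=> zC xC; apply: tens_eval_inj => a; rewrite implZE !t_implE.
by rewrite xC mulrA Ehat_mulr.
Qed.

Lemma t_impl_A_right r a : tens_eval (t_ (iA r)) a = harpoon H lambda (a * r) |> 1.
Proof. by rewrite t_implE rtimes1M Ehat_rtimes mul1r. Qed.

Lemma t_impl_trivial : t_ @` one_rtimes_A_right T = trivial_implementers T.
Proof.
apply/seteqP; split=> [_ [_ [r rR <-] <-]|t /trivial_implementersE[phi phiL e]].
  apply/trivial_implementersE; have [phi phiL E] := left_integral_mulr lambda_int rR.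
  by exists phi => // a; rewrite t_impl_A_right E.
(* By [antipode_harpoon] this element is S(h_1) (phi -> h_2). *)
exists (iA (eps_right H (harpoon H phi h))).
  by exists (eps_right H (harpoon H phi h)) => //; apply: A_right_eps.
apply: tens_eval_inj => a; rewrite t_impl_A_right e.
by rewrite (harpoon_integral hH lambda_int lambda_dual).
Qed.

Lemma commutantM z r : center z -> A_right H r -> commutant T (rtimes T z r).
Proof.
move=> zC rR m; rewrite rtimes_mull -zC (rtimes_split z) -mulrA.
by rewrite -A_right_comm // -rtimes_split rtimes_mull.
Qed.

End Implementers.
End Crossed.

(** * The isomorphism and outerness *)

Lemma image_addspan (V W : zmodType) (f : V -> W) (X : set V) :
  {morph f : x y / x + y} -> f @` addspan X = addspan (f @` X).
Proof.
move=> fD; have f0 : f 0 = 0 by apply: (addrI (f 0)); rewrite -fD !addr0.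
apply/seteqP; split=> [_ [_ [s sX ->] <-]|_ [s + ->]].
  exists [seq f x | x <- s]; last by rewrite big_map (big_morph f fD f0).
  by move=> _ /mapP[x /sX xX ->]; exists x.
elim: s => [|y s IH] sX.
  by exists 0; [exists [::]; rewrite ?big_nil|rewrite big_nil].
have [x xX fx] := sX y (mem_head _ _).
have [|v [r rX ->] fr] := IH; first by move=> w ws; apply: sX; rewrite inE ws orbT.
exists (x + \sum_(z <- r) z); last by rewrite fD fr fx big_cons.
exists (x :: r); last by rewrite big_cons.
by move=> w; rewrite inE => /orP[/eqP ->|/rX].
Qed.

Theorem theorem4p2p3 (R : realType) (A : falgType R[i]) (H : weak_Cstar_Hopf A)
    (M : algType R[i]) (T : module_algebra H M)
    (h : A) (h_Haar : Haar_integral H h)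
    (lambda : dual A) (lambda_int : left_integral H lambda)
    (lambda_dual : harpoon H lambda h = 1) :
  [/\ [/\ set_bij (commutant T) (implementers T) (t_impl T lambda),
          {in commutant T &, {morph t_impl T lambda : x y / x + y}} &
          forall z x, center z -> commutant T x ->
            t_impl T lambda (rtimes T z 1 * x) =
            implZ z (t_impl T lambda x)],
      one_rtimes_A_right T `<=` commutant T /\
        t_impl T lambda @` one_rtimes_A_right T = trivial_implementers T &
      outer T <-> commutant T = center_rtimes_A_right T].
Proof.
have tD := t_implD (T := T) lambda.
have t_inj := t_impl_inj (T := T) h_Haar lambda_int lambda_dual.
have triv := t_impl_trivial T h_Haar lambda_int lambda_dual.
have im : t_impl T lambda @` commutant T = implementers T.
  apply/seteqP; split=> [_ [x xC <-]|t tI]; first exact: t_impl_implementers.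
  by have [x xC <-] := t_impl_surj h_Haar lambda_int lambda_dual tI; exists x.
have oneC : one_rtimes_A_right T `<=` commutant T.
  by move=> _ [r rR <-]; apply: commutantM => // m; rewrite mul1r mulr1.
(* A generator z r is the product of z and 1 r, so [t_implZ] sends it to z times a trivial
   implementer. *)
have imZ : t_impl T lambda @` center_rtimes_A_right T =
    addspan [set x | exists z t,
      [/\ center z, trivial_implementers T t & x = implZ z t]].
  rewrite image_addspan //; congr addspan; apply/seteqP; split.
    move=> _ [_ [z [r [zC rR ->]] <-]]; exists z, (t_impl T lambda (rtimes T 1 r)).
    split=> //; first by rewrite -triv; exists (rtimes T 1 r) => //; exists r.
    by rewrite rtimes_split t_implZ //; apply: oneC; exists r.
  move=> _ [z [t [zC + ->]]]; rewrite -triv => -[_ [r rR <-] <-].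
  exists (rtimes T z r); first by exists z, r.
  by rewrite rtimes_split t_implZ //; apply: oneC; exists r.
split; [split|by split|].
- split=> [x xC|x y _ _|t tI]; [|exact: t_inj|by rewrite im].
  exact: t_impl_implementers.
- by move=> x y _ _; apply: tD.
- by move=> z x; apply: t_implZ.
(* Both sides of outerness are images under the injective t, so the equality pulls back. *)
rewrite /outer -im -imZ; split=> [e|-> //].
have sub (X Y : set (crossed T)) :
    t_impl T lambda @` X `<=` t_impl T lambda @` Y -> X `<=` Y.
  by move=> XY x Xx; have [|y Yy /t_inj <-] := XY (t_impl T lambda x); first by exists x.
by apply/seteqP; split; apply: sub; rewrite e.
Qed.
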